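(* Let $X$ be a complex Banach space, let $T:\mathbb{R}_{\ge 0}\to\mathcal{L}(X)$ have the semigroup property and assume that there is some $t_0>0$ such that for every $x\in X$ the orbit $s\mapsto T(s)x$ is real analytic on $(t_0,\infty)$. Then, for each $t>t_0$, there exists an open domain $\Omega_t$ of $\mathbb{C}$ such that: (i) $[t,\infty)\subseteq\Omega_t$ and $\{h\}+\Omega_t\subseteq\Omega_t$ for all $h\ge 0$; (ii) $(\Omega_t,+)$ is a semigroup, i.e. $z+w\in\Omega_t$ for all $z,w\in\Omega_t$; (iii) there is an angle $\theta_t\in(0,\pi/2]$ such that the sector $S(t,\theta_t)=\{z\in\mathbb{C} : \operatorname{Re} z>t \text{ and } |\arg(z-t)|<\theta_t\}$ is contained in $\Omega_t$; (iv) $T$ can be extended to a holomorphic function $T:\Omega_t\to\mathcal{L}(X)$ which conserves the semigroup property, that is, $T(z+w)=T(z)T(w)$ for all $z,w\in\Omega_t\cup\mathbb{R}_{\ge 0}$.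
   Context: $\mathcal{L}(X)$ is the Banach space of bounded linear operators on $X$ with the operator norm; $\mathbb{R}_{\ge 0}=[0,\infty)$. A function $T:\mathbb{R}_{\ge 0}\to\mathcal{L}(X)$ has the semigroup property if $T(s+t)=T(s)T(t)$ for all $s,t\in\mathbb{R}_{\ge 0}$ (no continuity and no condition on $T(0)$ is assumed). An $X$-valued function $f$ is real analytic on an open set $W\subseteq\mathbb{R}$ if for each $s_0\in W$ there are $r>0$ and a sequence $(x_k)_{k\ge 0}$ in $X$ such that $f(s)=\sum_{k=0}^\infty (s-s_0)^k x_k$ for all $s\in(s_0-r,s_0+r)$. A domain is a connected open subset of $\mathbb{C}$; $\arg$ is the principal argument. The extension in (iv) agrees with the original $T$ on $\Omega_t\cap\mathbb{R}_{\ge 0}$, so that $T$ is defined on $\Omega_t\cup\mathbb{R}_{\ge 0}$. *)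

(* Defs.v *)
From Stdlib Require Import Reals Lra FunctionalExtensionality ProofIrrelevance.
From Coquelicot Require Import Coquelicot.

Set Implicit Arguments.
Unset Strict Implicit.
Unset Printing Implicit Defensive.

Open Scope R_scope.

Section BoundedOperators.

Variable X : NormedModule C_AbsRing.

(* [is_linear] is Coquelicot's predicate for linear maps that are bounded. *)
Record bounded_op : Type := BoundedOp {
  op_fun :> X -> X;
  op_linear : is_linear op_fun
}.

Lemma bounded_op_ext (f g : bounded_op) : (forall x, f x = g x) -> f = g.
Proof.
destruct f as [f Hf], g as [g Hg]; simpl; intros H.
assert (E : f = g) by now apply functional_extensionality.
subst g; now rewrite (proof_irrelevance _ Hf Hg).
Qed.

Definition op_plus (f g : bounded_op) : bounded_op :=
  @BoundedOp (fun x => plus (f x) (g x))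
    (is_linear_comp _ _ (is_linear_prod _ _ (op_linear f) (op_linear g))
       is_linear_plus).

Definition op_opp (f : bounded_op) : bounded_op :=
  @BoundedOp (fun x => opp (f x))
    (is_linear_comp _ _ (op_linear f) is_linear_opp).

Definition op_zero : bounded_op :=
  @BoundedOp (fun _ => zero) is_linear_zero.

Definition op_scal (a : C) (f : bounded_op) : bounded_op :=
  @BoundedOp (fun x => scal a (f x))
    (is_linear_comp _ _ (op_linear f)
       (is_linear_scal_r (K := C_AbsRing) a Cmult_comm)).

Definition op_comp (f g : bounded_op) : bounded_op :=
  @BoundedOp (fun x => f (g x))
    (is_linear_comp _ _ (op_linear g) (op_linear f)).

Definition op_norm (f : bounded_op) : R :=
  real (Lub_Rbar (fun r => exists x : X, norm x <= 1 /\ r = norm (f x))).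

Lemma op_norm_lub (f : bounded_op) :
  is_lub_Rbar (fun r => exists x : X, norm x <= 1 /\ r = norm (f x))
    (Finite (op_norm f)).
Proof.
unfold op_norm; set (E := fun r => _).
assert (H := Lub_Rbar_correct E).
assert (H0 : E 0).
{ exists zero; rewrite (linear_zero _ (op_linear f)), !norm_zero.
  split; [lra | reflexivity]. }
destruct (linear_norm _ (op_linear f)) as [M [HM Hf]].
assert (HE : Rbar_le (Lub_Rbar E) (Finite M)).
{ apply (proj2 H); intros r [x [Hx ->]]; simpl.
  apply Rle_trans with (1 := Hf x).
  rewrite <- (Rmult_1_r M) at 2; apply Rmult_le_compat_l; lra. }
assert (HE0 := proj1 H 0 H0).
now destruct (Lub_Rbar E).
Qed.

Lemma op_norm_ge0 (f : bounded_op) : 0 <= op_norm f.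
Proof.
apply (proj1 (op_norm_lub f)); exists zero.
rewrite (linear_zero _ (op_linear f)), !norm_zero.
split; [lra | reflexivity].
Qed.

Lemma op_norm_bound (f : bounded_op) (x : X) :
  norm (f x) <= op_norm f * norm x.
Proof.
destruct (Req_dec (norm x) 0) as [Hx | Hx].
{ rewrite (norm_eq_zero _ Hx), (linear_zero _ (op_linear f)), !norm_zero; lra. }
assert (Hp : 0 < norm x) by (assert (H := norm_ge_0 x); lra).
set (y := scal (RtoC (/ norm x)) x : X).
assert (Hy : norm y <= 1).
{ apply Rle_trans with (1 := norm_scal (K := C_AbsRing) (RtoC (/ norm x)) x).
  change (Cmod (RtoC (/ norm x)) * norm x <= 1).
  rewrite Cmod_R, Rabs_pos_eq.
  - rewrite Rinv_l; lra.
  - now apply Rlt_le, Rinv_0_lt_compat. }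
assert (Hxy : f x = scal (RtoC (norm x)) (f y)).
{ unfold y; rewrite (linear_scal _ (op_linear f)), scal_assoc.
  change (f x = scal (Cmult (RtoC (norm x)) (RtoC (/ norm x))) (f x)).
  rewrite <- RtoC_mult, Rinv_r by lra.
  symmetry; exact (scal_one (f x)). }
rewrite Hxy.
apply Rle_trans with (1 := norm_scal (K := C_AbsRing) (RtoC (norm x)) (f y)).
change (Cmod (RtoC (norm x)) * norm (f y) <= op_norm f * norm x).
rewrite Cmod_R, Rabs_pos_eq by lra.
rewrite Rmult_comm; apply Rmult_le_compat_r; [lra |].
apply (proj1 (op_norm_lub f)); now exists y.
Qed.

Lemma op_norm_le (f : bounded_op) (M : R) :
  0 <= M -> (forall x, norm (f x) <= M * norm x) -> op_norm f <= M.
Proof.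
intros HM H.
apply (proj2 (op_norm_lub f) (Finite M)); intros r [x [Hx ->]]; simpl.
apply Rle_trans with (1 := H x).
rewrite <- (Rmult_1_r M) at 2; now apply Rmult_le_compat_l.
Qed.

Lemma op_norm_plus (f g : bounded_op) :
  op_norm (op_plus f g) <= op_norm f + op_norm g.
Proof.
apply op_norm_le.
- assert (H := op_norm_ge0 f); assert (H' := op_norm_ge0 g); lra.
- intros x; apply Rle_trans with (1 := norm_triangle _ _).
  assert (H := op_norm_bound f x); assert (H' := op_norm_bound g x); lra.
Qed.

Lemma op_norm_scal (a : C) (f : bounded_op) :
  op_norm (op_scal a f) <= Cmod a * op_norm f.
Proof.
assert (Ha := Cmod_ge_0 a).
apply op_norm_le.
- apply Rmult_le_pos; [exact Ha | apply op_norm_ge0].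
- intros x; apply Rle_trans with (1 := norm_scal (K := C_AbsRing) a (f x)).
  rewrite Rmult_assoc; apply Rmult_le_compat_l; [exact Ha |].
  apply op_norm_bound.
Qed.

Lemma op_norm_eq_zero (f : bounded_op) : op_norm f = 0 -> f = op_zero.
Proof.
intros Hf; apply bounded_op_ext; intros x; apply norm_eq_zero.
assert (H := op_norm_bound f x); rewrite Hf in H.
assert (H' := norm_ge_0 (f x)); lra.
Qed.

Lemma op_plus_comm (f g : bounded_op) : op_plus f g = op_plus g f.
Proof. apply bounded_op_ext; intros x; apply plus_comm. Qed.

Lemma op_plus_assoc (f g h : bounded_op) :
  op_plus f (op_plus g h) = op_plus (op_plus f g) h.
Proof. apply bounded_op_ext; intros x; apply plus_assoc. Qed.

Lemma op_plus_zero_r (f : bounded_op) : op_plus f op_zero = f.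
Proof. apply bounded_op_ext; intros x; apply plus_zero_r. Qed.

Lemma op_plus_opp_r (f : bounded_op) : op_plus f (op_opp f) = op_zero.
Proof. apply bounded_op_ext; intros x; exact (plus_opp_r (f x)). Qed.

Definition op_AbelianMonoid_mixin :=
  AbelianMonoid.Mixin bounded_op op_plus op_zero
    op_plus_comm op_plus_assoc op_plus_zero_r.

Canonical op_AbelianMonoid :=
  AbelianMonoid.Pack bounded_op op_AbelianMonoid_mixin bounded_op.

Definition op_AbelianGroup_mixin :=
  AbelianGroup.Mixin op_AbelianMonoid op_opp op_plus_opp_r.

Canonical op_AbelianGroup :=
  AbelianGroup.Pack bounded_op
    (AbelianGroup.Class _ _ op_AbelianGroup_mixin) bounded_op.

Lemma op_scal_assoc (a b : C) (f : bounded_op) :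
  op_scal a (op_scal b f) = op_scal (Cmult a b) f.
Proof.
apply bounded_op_ext; intros x; exact (scal_assoc (K := C_AbsRing) a b (f x)).
Qed.

Lemma op_scal_one (f : bounded_op) : op_scal (RtoC 1) f = f.
Proof.
apply bounded_op_ext; intros x; exact (scal_one (K := C_AbsRing) (f x)).
Qed.

Lemma op_scal_distr_l (a : C) (f g : bounded_op) :
  op_scal a (op_plus f g) = op_plus (op_scal a f) (op_scal a g).
Proof.
apply bounded_op_ext; intros x.
exact (scal_distr_l (K := C_AbsRing) a (f x) (g x)).
Qed.

Lemma op_scal_distr_r (a b : C) (f : bounded_op) :
  op_scal (Cplus a b) f = op_plus (op_scal a f) (op_scal b f).
Proof.
apply bounded_op_ext; intros x.
exact (scal_distr_r (K := C_AbsRing) a b (f x)).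
Qed.

Definition op_ModuleSpace_mixin :=
  ModuleSpace.Mixin C_Ring op_AbelianGroup op_scal
    op_scal_assoc op_scal_one op_scal_distr_l op_scal_distr_r.

Canonical op_ModuleSpace :=
  ModuleSpace.Pack C_Ring bounded_op
    (ModuleSpace.Class _ _ _ op_ModuleSpace_mixin) bounded_op.

Definition op_ball (f : bounded_op) (e : R) (g : bounded_op) : Prop :=
  op_norm (minus g f) < e.

Lemma op_ball_center (f : bounded_op) (e : posreal) : op_ball f e f.
Proof.
unfold op_ball; rewrite minus_eq_zero.
apply Rle_lt_trans with 0; [| apply cond_pos].
apply op_norm_le; [lra |].
intros x; simpl; rewrite norm_zero; lra.
Qed.

Lemma op_ball_sym (f g : bounded_op) (e : R) : op_ball f e g -> op_ball g e f.
Proof.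
unfold op_ball; apply Rle_lt_trans.
apply op_norm_le; [apply op_norm_ge0 |].
intros x; rewrite <- opp_minus; simpl; rewrite norm_opp.
apply (op_norm_bound (minus g f)).
Qed.

Lemma op_ball_triangle (f g h : bounded_op) (e1 e2 : R) :
  op_ball f e1 g -> op_ball g e2 h -> op_ball f (e1 + e2) h.
Proof.
unfold op_ball; intros H1 H2.
rewrite (minus_trans g h f).
assert (H := op_norm_plus (minus h g) (minus g f)).
apply Rle_lt_trans with (1 := H); lra.
Qed.

Definition op_UniformSpace_mixin :=
  UniformSpace.Mixin bounded_op op_zero op_ball op_ball_center op_ball_sym op_ball_triangle.

Canonical op_UniformSpace :=
  UniformSpace.Pack bounded_op op_UniformSpace_mixin bounded_op.

Canonical op_NormedModuleAux :=
  NormedModuleAux.Pack C_AbsRing bounded_op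
    (NormedModuleAux.Class _ _
       (ModuleSpace.class _ op_ModuleSpace) op_UniformSpace_mixin)
    bounded_op.

Lemma op_norm_compat1 (f g : bounded_op) (e : R) :
  op_norm (minus g f) < e -> ball f e g.
Proof. easy. Qed.

Lemma op_norm_compat2 (f g : bounded_op) (e : posreal) :
  ball f e g -> op_norm (minus g f) < 1 * e.
Proof. now rewrite Rmult_1_l. Qed.

Definition op_NormedModule_mixin :=
  NormedModule.Mixin _ op_NormedModuleAux op_norm 1
    op_norm_plus op_norm_scal op_norm_compat1 op_norm_compat2 op_norm_eq_zero.

(* L(X) with the operator norm. *)
Canonical op_NormedModule :=
  NormedModule.Pack C_AbsRing bounded_op
    (NormedModule.Class _ _ _ op_NormedModule_mixin) bounded_op.

End BoundedOperators.

Definition real_analytic_on (X : NormedModule C_AbsRing) (f : R -> X)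
    (W : R -> Prop) : Prop :=
  forall s0 : R, W s0 ->
    exists (r : posreal) (a : nat -> X),
      forall s : R, s0 - r < s < s0 + r -> is_pseries a (RtoC (s - s0)) (f s).

(* Values of T at negative arguments are irrelevant. *)
Definition semigroup_property (X : NormedModule C_AbsRing)
    (T : R -> bounded_op X) : Prop :=
  forall s t : R, 0 <= s -> 0 <= t -> T (s + t) = op_comp (T s) (T t).

Definition connected (T : UniformSpace) (A : T -> Prop) : Prop :=
  forall U V : T -> Prop, open U -> open V ->
    (forall x, A x -> U x \/ V x) ->
    (exists x, A x /\ U x) -> (exists x, A x /\ V x) ->
    exists x, A x /\ U x /\ V x.

Definition is_domain (Omega : C -> Prop) : Prop := open Omega /\ connected Omega.

(* Principal argument, with values in (-PI, PI]; junk value at 0. *)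
Definition Carg (z : C) : R :=
  if Rlt_dec (Im z) 0 then - acos (Re z / Cmod z) else acos (Re z / Cmod z).

Definition sector (t theta : R) (z : C) : Prop :=
  t < Re z /\ Rabs (Carg (Cminus z (RtoC t))) < theta.

Definition holomorphic_on (V : NormedModule C_AbsRing) (f : C -> V)
    (Omega : C -> Prop) : Prop :=
  forall z : C, Omega z -> ex_derive (K := C_AbsRing) f z.

Definition nonneg_real (z : C) : Prop := exists s : R, 0 <= s /\ z = RtoC s.

(* Main.v *)
Require Import Defs.
From Stdlib Require Import Reals Factorial Lra Lia ClassicalEpsilon.
From Coquelicot Require Import Coquelicot.
Open Scope R_scope.

(** Write [D_k(s)] for the [k]-th derivative of [T] at [s > t0] and [e_k(z)] for
    [z^k / k!].  Everything below is a manipulation of Taylor series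
    [T(s + u) = sum_k e_k(u) D_k(s)], summed pointwise on [X] but controlled by
    the operator norms of the coefficients.

    _From orbits to operators._  For each [x] the orbit has Taylor coefficients
    at [s].  Each coefficient is a pointwise limit of combinations of bounded
    operators, so it is a bounded operator by the Banach-Steinhaus theorem.
    Baire's theorem is used twice more: on the sets of [x] whose coefficients
    grow at most geometrically at a given rate, which gives
    [sum_k e_k(r) |D_k(s)| < oo] for some [r > 0]; and on the sets of [x] whose
    expansion is valid on a given interval.  These last sets are closed
    subspaces, so one of them is all of [X] and the radius does not depend on
    [x] ([norm_analytic]).

    _Algebra of the coefficients._  Uniqueness of Taylor coefficients turns the
    semigroup law into [D_j(s + h) = D_j(s) T(h) = T(h) D_j(s)] for [h >= 0] and
    [D_{j+k}(c + d) = D_j(c) D_k(d)] ([coef_add]).  If the series of norms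
    converges at [c] with radius [rho] and at [d] with radius [rho'], the Cauchy
    product of the two shows that it converges at [c + d] with radius
    [rho + rho'] ([abs_conv_add]): radii add up.

    _The region._  Let [Omega] be the set of [z] such that, for some [c] with
    [t0 < c < Re z] and some [rho > |Im z|], the series of norms converges at [c]
    with radius [rho].  It is open, stable under translation by [h >= 0], and
    stable under addition because radii add up.  A single pair [(c, r)] with
    [t0 < c < t] produces the pairs [(n c, n r)], so [Omega] contains the cone
    [|Im z| < (r / t) (Re z - t)].

    _The extension._  Put [T(z) = sum_k e_k(i Im z) D_k(Re z)].  The law
    [T(z + w) = T(z) T(w)] is the Cauchy product of two such series, by
    [coef_add].  For holomorphy, regrouping the double series ([dpow_reexpand])
    identifies [T] near [z] with a power series in [w - Re z], and a second
    regrouping expands it in powers of [w - z].  That regrouping is the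
    binomial formula for the [e_k] together with Fubini's theorem for absolutely
    convergent double series. *)

(** * Norm inequalities and series *)

Lemma minus_plus_plus {G : AbelianGroup} (a b c d : G) :
  minus (plus a b) (plus c d) = plus (minus a c) (minus b d).
Proof.
unfold minus; rewrite opp_plus, <- !plus_assoc; f_equal.
rewrite !plus_assoc; f_equal; apply plus_comm.
Qed.

Lemma minus_plus_r {G : AbelianGroup} (a b c : G) :
  minus a (plus b c) = minus (minus a b) c.
Proof. unfold minus; now rewrite opp_plus, plus_assoc. Qed.

Lemma plus_minus_cancel {G : AbelianGroup} (a b : G) : a = plus (minus a b) b.
Proof.
unfold minus; rewrite <- plus_assoc, plus_opp_l; symmetry; apply plus_zero_r.
Qed.

Lemma minus_plus_l {G : AbelianGroup} (a b : G) : minus (plus a b) a = b.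
Proof.
transitivity (plus b (minus a a)).
- unfold minus; rewrite plus_assoc; f_equal; apply plus_comm.
- rewrite minus_eq_zero; apply plus_zero_r.
Qed.

Lemma sum_n_telescope {G : AbelianGroup} (s : nat -> G) (n : nat) :
  sum_n (fun k => minus (s (S k)) (s k)) n = minus (s (S n)) (s 0%nat).
Proof.
induction n as [| n IH]; [now rewrite sum_O |].
rewrite sum_Sn, IH, plus_comm; symmetry; apply minus_trans.
Qed.

Section Series.
Context {K : AbsRing} {V : NormedModule K}.

(** The balls of the uniform structure need not be the norm balls; this is the norm form. *)
Lemma is_series_eps (a : nat -> V) (l : V) :
  is_series a l <->
  (forall eps, 0 < eps ->
     exists N, forall n, (N <= n)%nat -> norm (minus (sum_n a n) l) < eps).
Proof.
assert (H := filterlim_locally_ball_norm (F := eventually) (sum_n a) l).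
split.
- intros Hs e He; exact (proj1 H Hs (mkposreal e He)).
- intros Hs; apply H; intros [e He]; exact (Hs e He).
Qed.

Lemma is_series_uniq (a : nat -> V) (l l' : V) :
  is_series a l -> is_series a l' -> l = l'.
Proof. apply filterlim_locally_unique. Qed.

Lemma norm_sum_n (a : nat -> V) (n : nat) :
  norm (sum_n a n) <= sum_n (fun k => norm (a k)) n.
Proof. apply norm_sum_n_m. Qed.

Lemma norm_minus_sym (x y : V) : norm (minus x y) = norm (minus y x).
Proof. now rewrite <- opp_minus, norm_opp. Qed.

Lemma norm_minus_triangle (x y z : V) :
  norm (minus x z) <= norm (minus x y) + norm (minus y z).
Proof. rewrite (minus_trans y x z); apply norm_triangle. Qed.

Lemma norm_minus_self (x : V) :
  norm (minus x x) = 0.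
Proof.
transitivity (norm (zero : V)); [f_equal; exact (minus_eq_zero x) | exact norm_zero].
Qed.

Lemma norm_minus_plus_l (p q a : V) :
  norm (minus (plus p a) q) <= norm (minus p q) + norm a.
Proof.
apply Rle_trans with (norm (plus (minus p q) a)).
- right; f_equal; unfold minus; rewrite <- !plus_assoc; f_equal; apply plus_comm.
- apply norm_triangle.
Qed.

Lemma norm_minus_plus_plus (a b c d : V) :
  norm (minus (plus a b) (plus c d)) <= norm (minus a c) + norm (minus b d).
Proof.
apply Rle_trans with (norm (plus (minus a c) (minus b d))).
- right; f_equal; exact (minus_plus_plus (G := V) a b c d).
- apply norm_triangle.
Qed.

Lemma norm_limit_le (l : V) (B : R) (f : nat -> V) (y : V) :
  (forall eps, 0 < eps ->
     exists N, forall n, (N <= n)%nat -> norm (minus (f n) l) < eps) ->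
  (exists N, forall n, (N <= n)%nat -> norm (minus (f n) y) <= B) ->
  norm (minus l y) <= B.
Proof.
intros Hf [N HN]; apply le_epsilon; intros e He.
destruct (Hf e He) as [N' HN'].
specialize (HN (max N N') (Nat.le_max_l _ _)).
specialize (HN' (max N N') (Nat.le_max_r _ _)).
rewrite norm_minus_sym in HN'.
assert (H := norm_minus_triangle l (f (max N N')) y); lra.
Qed.

End Series.

Lemma sum_n_le_loc (a b : nat -> R) (n : nat) :
  (forall k, (k <= n)%nat -> a k <= b k) -> sum_n a n <= sum_n b n.
Proof.
intros H; induction n as [| n IH].
- rewrite !sum_O; apply H; lia.
- rewrite !sum_Sn; apply Rplus_le_compat; [apply IH; intros; apply H; lia | apply H; lia].
Qed.

Lemma sum_n_ge0 (a : nat -> R) (n : nat) :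
  (forall k, 0 <= a k) -> 0 <= sum_n a n.
Proof.
intros H; induction n as [| n IH].
- rewrite sum_O; apply H.
- rewrite sum_Sn; apply Rplus_le_le_0_compat; auto.
Qed.

Lemma sum_n_grow (a : nat -> R) (n m : nat) :
  (forall k, 0 <= a k) -> (n <= m)%nat -> sum_n a n <= sum_n a m.
Proof.
intros H; induction 1 as [| m _ IH]; [lra |].
rewrite sum_Sn; unfold plus; simpl; specialize (H (S m)); lra.
Qed.

Lemma sum_n_le_series (a : nat -> R) (L : R) (n : nat) :
  (forall k, 0 <= a k) -> is_series a L -> sum_n a n <= L.
Proof.
intros H HL; apply (is_lim_seq_incr_compare (sum_n a)); [exact HL |].
intros k; rewrite sum_Sn; unfold plus; simpl; specialize (H (S k)); lra.
Qed.

Lemma ex_series_bounded (a : nat -> R) (B : R) :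
  (forall k, 0 <= a k) -> (forall n, sum_n a n <= B) -> ex_series a.
Proof.
intros H HB.
destruct (ex_finite_lim_seq_incr (sum_n a) B) as [l Hl]; auto.
- intros n; apply sum_n_grow; auto.
- now exists l.
Qed.

Lemma ex_series_le_R (a b : nat -> R) :
  (forall n, 0 <= a n <= b n) -> ex_series b -> ex_series a.
Proof.
intros H; apply (ex_series_le (V := R_CompleteNormedModule)); intros n.
change (Rabs (a n) <= b n).
rewrite Rabs_pos_eq; apply H.
Qed.

(** Both sides run over the triangle [j + k <= J], by diagonals and by rows. *)
Lemma sum_n_triangle {G : AbelianMonoid} (g : nat -> nat -> G) (J : nat) :
  sum_n (fun m => sum_n (fun j => g j (m - j)%nat) m) J =
  sum_n (fun j => sum_n (g j) (J - j)) J.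
Proof.
induction J as [| J IH].
- now rewrite !sum_O.
- rewrite sum_Sn, IH, sum_Sn, (sum_Sn _ J), plus_assoc.
  rewrite <- sum_n_plus, Nat.sub_diag, sum_O; f_equal.
  apply sum_n_ext_loc; intros j Hj.
  now rewrite (Nat.sub_succ_l j J Hj), sum_Sn.
Qed.

(** * Fubini's theorem for double series *)

Section Fubini.
Context {K : AbsRing} {V : CompleteNormedModule K}.
Variable g : nat -> nat -> V.
Hypothesis Hg :
  ex_series (fun m => sum_n (fun j => norm (g j (m - j)%nat)) m).

(** The rectangle [J] by [N] lies inside the triangle of size [J + N]. *)
Lemma double_sum_le (B : R) (J N : nat) :
  is_series (fun m => sum_n (fun j => norm (g j (m - j)%nat)) m) B ->
  sum_n (fun j => sum_n (fun k => norm (g j k)) N) J <= B.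
Proof.
intros HB.
apply Rle_trans with (2 := sum_n_le_series _ _ (J + N)
  (fun m => sum_n_ge0 _ m (fun j => norm_ge_0 (g j (m - j)%nat))) HB).
rewrite (sum_n_triangle (fun j k => norm (g j k))).
apply Rle_trans with
  (sum_n (fun j => sum_n (fun k => norm (g j k)) (J + N - j)) J).
- apply sum_n_le_loc; intros j Hj; apply sum_n_grow; [| lia].
  intros k; apply norm_ge_0.
- apply sum_n_grow; [| lia].
  intros j; apply sum_n_ge0; intros k; apply norm_ge_0.
Qed.

Lemma fubini_row (j : nat) : ex_series (fun k => norm (g j k)).
Proof.
destruct Hg as [B HB].
apply ex_series_bounded with B; [intros k; apply norm_ge_0 |].
intros N; apply Rle_trans with (2 := double_sum_le B j N HB).
destruct j as [| j]; [rewrite sum_O; lra |].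
rewrite (sum_Sn _ j).
assert (H := sum_n_ge0 (fun j => sum_n (fun k => norm (g j k)) N) j
  (fun i => sum_n_ge0 _ N (fun k => norm_ge_0 (g i k)))).
unfold plus; simpl; lra.
Qed.

(** The row norms are summable as well; this is what later bounds the coefficients of
    a re-expanded series. *)
Lemma fubini_norm : ex_series (fun j => Series (fun k => norm (g j k))).
Proof.
destruct Hg as [B HB].
assert (Hpos : forall j, 0 <= Series (fun k => norm (g j k))).
{ intros j; apply Rle_trans with (sum_n (fun k => norm (g j k)) 0).
  - apply sum_n_ge0; intros k; apply norm_ge_0.
  - apply sum_n_le_series; [intros k; apply norm_ge_0 |].
    apply Series_correct, fubini_row. }
apply ex_series_bounded with B; [exact Hpos |]; intros J.
apply (is_lim_seq_le (fun N => sum_n (fun j => sum_n (fun k => norm (g j k)) N) J)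
  (fun _ => B) (sum_n (fun j => Series (fun k => norm (g j k))) J) B).
- intros N; now apply double_sum_le.
- induction J as [| J IH].
  + apply is_lim_seq_ext with (sum_n (fun k => norm (g 0%nat k))).
    { intros N; now rewrite sum_O. }
    rewrite sum_O; apply Series_correct, fubini_row.
  + apply is_lim_seq_ext with
      (fun N => sum_n (fun j => sum_n (fun k => norm (g j k)) N) J
                + sum_n (fun k => norm (g (S J) k)) N).
    { intros N; now rewrite (sum_Sn _ J). }
    rewrite sum_Sn; apply is_lim_seq_plus'; [exact IH |].
    apply (Series_correct (fun k => norm (g (S J) k))), fubini_row.
- apply is_lim_seq_const.
Qed.

(** The first [J] rows and the first [J] diagonals differ by terms that all lie
    on later diagonals, so their distance is at most the tail [B - A] of the
    diagonal series of norms.  Diagonals [j + k = m] are the order in which products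
    of power series are summed. *)
Lemma fubini (row : nat -> V) (l : V) :
  (forall j, is_series (g j) (row j)) ->
  is_series (fun m => sum_n (fun j => g j (m - j)%nat) m) l ->
  is_series row l.
Proof.
intros Hrow Hl.
destruct Hg as [B HB].
apply is_series_eps; intros e He.
assert (HB' := proj1 (is_series_eps _ _) HB).
destruct (HB' (e / 2) ltac:(lra)) as [N1 HN1].
destruct (proj1 (is_series_eps _ _) Hl (e / 2) ltac:(lra)) as [N2 HN2].
exists (max N1 N2); intros J HJ.
set (A := sum_n (fun m => sum_n (fun j => norm (g j (m - j)%nat)) m) J).
set (D := sum_n (fun m => sum_n (fun j => g j (m - j)%nat) m) J).
assert (HA : B - A < e / 2).
{ specialize (HN1 J ltac:(lia)); fold A in HN1.
  change (Rabs (A - B) < e / 2) in HN1.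
  apply Rabs_def2 in HN1; lra. }
assert (HD : norm (minus (sum_n row J) D) <= B - A).
{ apply norm_limit_le with (fun N => sum_n (fun j => sum_n (g j) N) J).
  - assert (H : filterlim (fun N => sum_n (fun j => sum_n (g j) N) J)
      eventually (locally (sum_n row J))).
    { clear -Hrow; induction J as [| J IH].
      + apply filterlim_ext with (sum_n (g 0%nat)).
        { intros N; now rewrite sum_O. }
        rewrite sum_O; apply Hrow.
      + apply filterlim_ext with
          (fun N => plus (sum_n (fun j => sum_n (g j) N) J) (sum_n (g (S J)) N)).
        { intros N; now rewrite (sum_Sn _ J). }
        rewrite sum_Sn.
        eapply filterlim_comp_2; [exact IH | apply (Hrow (S J)) |].
        apply (filterlim_plus (V := V)). }
    intros e' He'.
    exact (proj1 (filterlim_locally_ball_norm _ _) H (mkposreal e' He')).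
  - (* the rows truncated at [N] contain the triangle as soon as [N >= J] *)
    exists J; intros N HN.
    unfold D, A; rewrite sum_n_triangle.
    rewrite (sum_n_triangle (fun j k => norm (g j k))).
    assert (H := double_sum_le B J N HB).
    apply Rle_trans with
      (sum_n (fun j => sum_n (fun k => norm (g j k)) N) J
       - sum_n (fun j => sum_n (fun k => norm (g j k)) (J - j)) J); [| lra].
    assert (Hd : forall j, norm (minus (sum_n (g j) N) (sum_n (g j) (J - j))) <=
       sum_n (fun k => norm (g j k)) N - sum_n (fun k => norm (g j k)) (J - j)).
    { intros j.
      assert (Hj : (J - j <= N)%nat) by lia.
      apply Rle_trans with (norm (sum_n_m (g j) (S (J - j)) N)).
      { right; f_equal; symmetry; exact (sum_n_m_sum_n (g j) _ _ Hj). }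
      apply Rle_trans with (sum_n_m (fun k => norm (g j k)) (S (J - j)) N).
      2: right; exact (sum_n_m_sum_n (fun k => norm (g j k)) _ _ Hj).
      exact (norm_sum_n_m (V := V) (g j) _ _). }
    clear -Hd.
    set (a := fun j => sum_n (g j) (J - j)) in *.
    set (a' := fun j => sum_n (fun k => norm (g j k)) (J - j)) in *.
    set (b := fun j => sum_n (g j) N) in *.
    set (b' := fun j => sum_n (fun k => norm (g j k)) N) in *.
    assert (H : forall j, norm (minus (b j) (a j)) <= b' j - a' j) by exact Hd.
    clearbody a a' b b'; clear Hd.
    induction J as [| J IH]; [rewrite !sum_O; apply H |].
    rewrite !sum_Sn.
    eapply Rle_trans; [apply (norm_minus_plus_plus (V := V)) |].
    specialize (H (S J)).
    eapply Rle_trans; [exact (Rplus_le_compat _ _ _ _ IH H) |].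
    right; unfold plus; simpl; ring. }
assert (HN2' := HN2 J ltac:(lia)); fold D in HN2'.
replace e with (e / 2 + e / 2) by lra.
eapply Rle_lt_trans; [exact (norm_minus_triangle (V := V) (sum_n row J) D l) |].
apply Rplus_lt_compat; [exact (Rle_lt_trans _ _ _ HD HA) | exact HN2'].
Qed.
End Fubini.

(** * Divided powers and re-expansion of power series *)

(** Taylor series are written with [dpow k z = z^k / k!] and the derivatives as
    coefficients, so that shifting the base point is [b_{j+k}] without binomial
    coefficients.  [rdpow] is the same function on the reals, for norms. *)
Definition dpow (k : nat) (z : C) : C := (z ^ k / RtoC (INR (fact k)))%C.
Definition rdpow (k : nat) (r : R) : R := r ^ k / INR (fact k).

Lemma fact_C_neq0 (k : nat) : RtoC (INR (fact k)) <> 0%C.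
Proof.
intros H; apply (INR_fact_neq_0 k); exact (RtoC_inj _ _ H).
Qed.

Lemma dpow_O (z : C) : dpow 0 z = 1%C.
Proof. unfold dpow; simpl; field; exact C1_nz. Qed.

Lemma dpow_S (k : nat) (z : C) : (RtoC (INR (S k)) * dpow (S k) z = z * dpow k z)%C.
Proof.
unfold dpow; rewrite Cpow_S.
replace (fact (S k)) with (S k * fact k)%nat by reflexivity.
rewrite mult_INR, RtoC_mult; field; split; [apply fact_C_neq0 |].
intros H; apply (not_0_INR (S k)); [easy | exact (RtoC_inj _ _ H)].
Qed.

Lemma dpow_at_0 (k : nat) : dpow (S k) 0 = 0%C.
Proof.
unfold dpow; rewrite Cpow_S; field; apply fact_C_neq0.
Qed.

Lemma Cmod_dpow (k : nat) (z : C) : Cmod (dpow k z) = rdpow k (Cmod z).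
Proof.
unfold dpow, rdpow; rewrite Cmod_div by apply fact_C_neq0.
rewrite Cmod_pow, Cmod_R, Rabs_pos_eq by apply pos_INR; reflexivity.
Qed.

Lemma rdpow_ge0 (k : nat) (r : R) : 0 <= r -> 0 <= rdpow k r.
Proof.
intros H; apply Rmult_le_pos; [now apply pow_le |].
apply Rlt_le, Rinv_0_lt_compat, INR_fact_lt_0.
Qed.

Lemma rdpow_gt0 (k : nat) (r : R) : 0 < r -> 0 < rdpow k r.
Proof.
intros H; apply Rdiv_lt_0_compat; [now apply pow_lt | apply INR_fact_lt_0].
Qed.

Lemma rdpow_le (k : nat) (r r' : R) : 0 <= r <= r' -> rdpow k r <= rdpow k r'.
Proof.
intros H; apply Rmult_le_compat_r.
- apply Rlt_le, Rinv_0_lt_compat, INR_fact_lt_0.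
- now apply pow_incr.
Qed.

Lemma rdpow_binomial (m : nat) (x y : R) :
  sum_n (fun j => rdpow j y * rdpow (m - j) x) m = rdpow m (x + y).
Proof.
rewrite sum_n_Reals, Rplus_comm; unfold rdpow at 3; rewrite binomial.
unfold Rdiv; rewrite (Rmult_comm (sum_f_R0 _ _)), scal_sum; apply PartSum.sum_eq; intros j Hj.
unfold rdpow, Binomial.C; field.
repeat split; apply INR_fact_neq_0.
Qed.

Lemma sum_n_shift {G : AbelianMonoid} (a : nat -> G) (n : nat) :
  sum_n a (S n) = plus (a 0%nat) (sum_n (fun k => a (S k)) n).
Proof.
induction n as [| n IH]; [now rewrite sum_Sn, !sum_O |].
now rewrite sum_Sn, IH, sum_Sn, plus_assoc.
Qed.

(** Induction through [(m + 1) e_{m+1} = z e_m]: the weights [j] and [m + 1 - j]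
    on the [j]-th term add up to [m + 1], and each of them lowers one of the two
    exponents. *)
Lemma dpow_binomial (m : nat) (x y : C) :
  sum_n (fun j => Cmult (dpow j y) (dpow (m - j) x)) m = dpow m (x + y)%C.
Proof.
induction m as [| m IH].
{ rewrite sum_O; simpl; rewrite !dpow_O; ring. }
set (t := fun j => Cmult (dpow j y) (dpow (S m - j) x)).
assert (Hn : RtoC (INR (S m)) <> 0%C).
{ intros H; apply (not_0_INR (S m)); [easy | exact (RtoC_inj _ _ H)]. }
assert (H1 : sum_n (fun j => Cmult (RtoC (INR j)) (t j)) (S m) =
   (y * dpow m (x + y))%C).
{ rewrite sum_n_shift, <- IH.
  rewrite <- (sum_n_mult_l (K := C_Ring)).
  change (RtoC (INR 0) * t 0%nat +
    sum_n (fun k => (RtoC (INR (S k)) * t (S k))%C) m =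
    sum_n (fun k => (y * (dpow k y * dpow (m - k) x))%C) m)%C.
  replace (RtoC (INR 0) * t 0%nat)%C with (RtoC 0) by (simpl; ring).
  rewrite Cplus_0_l; apply sum_n_ext; intros j; unfold t.
  rewrite !Cmult_assoc, dpow_S; reflexivity. }
assert (H2 : sum_n (fun j => Cmult (RtoC (INR (S m - j))) (t j)) (S m) =
   (x * dpow m (x + y))%C).
{ rewrite sum_Sn, <- IH, Nat.sub_diag.
  rewrite <- (sum_n_mult_l (K := C_Ring)).
  change (sum_n (fun j => (RtoC (INR (S m - j)) * t j)%C) m +
    (RtoC (INR 0) * t (S m)) =
    sum_n (fun k => (x * (dpow k y * dpow (m - k) x))%C) m)%C.
  replace (RtoC (INR 0) * t (S m))%C with (RtoC 0) by (simpl; ring).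
  rewrite Cplus_0_r; apply sum_n_ext_loc; intros j Hj; unfold t.
  rewrite (Nat.sub_succ_l j m Hj).
  transitivity (dpow j y * (RtoC (INR (S (m - j))) * dpow (S (m - j)) x))%C;
    [match goal with |- @eq _ ?a ?b => change (@eq C a b) end; ring |].
  rewrite dpow_S; match goal with |- @eq _ ?a ?b => change (@eq C a b) end; ring. }
assert (H3 : (RtoC (INR (S m)) * sum_n t (S m) = RtoC (INR (S m)) * dpow (S m) (x + y))%C).
{ rewrite dpow_S.
  rewrite <- (sum_n_mult_l (K := C_Ring) (RtoC (INR (S m))) t).
  transitivity (sum_n (fun j => Cmult (RtoC (INR j)) (t j)) (S m) +
                sum_n (fun j => Cmult (RtoC (INR (S m - j))) (t j)) (S m))%C.
  - rewrite <- (sum_n_plus (G := C_AbelianMonoid)).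
    apply sum_n_ext_loc; intros j Hj.
    change (RtoC (INR (S m)) * t j = RtoC (INR j) * t j + RtoC (INR (S m - j)) * t j)%C.
    rewrite minus_INR by exact Hj; rewrite RtoC_minus; ring.
  - rewrite H1, H2; ring. }
fold t; revert H3; generalize (sum_n t (S m) : C); intros q H3.
change (@eq C q (dpow (S m) (x + y)%C)).
transitivity (/ RtoC (INR (S m)) * (RtoC (INR (S m)) * q))%C.
- field; exact Hn.
- rewrite H3; field; exact Hn.
Qed.

Lemma ex_series_rdpow_le (b : nat -> R) (r r' : R) :
  (forall k, 0 <= b k) -> 0 <= r <= r' ->
  ex_series (fun k => rdpow k r' * b k) -> ex_series (fun k => rdpow k r * b k).
Proof.
intros Hb Hr; apply ex_series_le_R; intros k; split.
- apply Rmult_le_pos; [now apply rdpow_ge0 | apply Hb].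
- apply Rmult_le_compat_r; [apply Hb | now apply rdpow_le].
Qed.

Lemma rdpow_double_series (b : nat -> R) (s t : R) :
  (forall k, 0 <= b k) -> 0 <= s -> 0 <= t ->
  ex_series (fun m => rdpow m (s + t) * b m) ->
  ex_series (fun m => sum_n (fun j =>
     rdpow j t * (rdpow (m - j) s * b (j + (m - j))%nat)) m).
Proof.
intros Hb Hs Ht; apply ex_series_ext; intros m.
rewrite <- rdpow_binomial.
rewrite <- (sum_n_mult_r (K := R_Ring)).
apply sum_n_ext_loc; intros j Hj.
replace (j + (m - j))%nat with m by lia.
unfold mult; simpl; ring.
Qed.

(** Re-expansion at distance [s] leaves the radius [t]; the new coefficients are
    dominated by the inner series.  The hypothesis [0 < t] is needed to recover the
    [j]-th row from its multiple by [e_j(t)]. *)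
Lemma rdpow_reexpand (b : nat -> R) (s t : R) :
  (forall k, 0 <= b k) -> 0 <= s -> 0 < t ->
  ex_series (fun m => rdpow m (s + t) * b m) ->
  (forall j, ex_series (fun k => rdpow k s * b (j + k)%nat)) /\
  ex_series (fun j => rdpow j t * Series (fun k => rdpow k s * b (j + k)%nat)).
Proof.
intros Hb Hs Ht H.
apply rdpow_double_series in H; [| assumption | assumption | lra].
set (g := fun j k => rdpow j t * (rdpow k s * b (j + k)%nat)).
assert (Hg0 : forall j k, norm (g j k) = g j k).
{ intros j k; apply Rabs_pos_eq; unfold g.
  apply Rmult_le_pos; [apply rdpow_ge0; lra |].
  apply Rmult_le_pos; [apply rdpow_ge0; lra | apply Hb]. }
assert (Hg : ex_series (fun m => sum_n (fun j => norm (g j (m - j)%nat)) m)).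
{ revert H; apply ex_series_ext; intros m; apply sum_n_ext; intros j.
  now rewrite Hg0. }
assert (Htj : forall j, 0 < rdpow j t).
{ intros j; now apply rdpow_gt0. }
split.
- intros j.
  assert (Hj := fubini_row (V := R_CompleteNormedModule) g Hg j).
  apply (ex_series_scal (V := R_NormedModule) (/ rdpow j t)) in Hj.
  revert Hj; apply ex_series_ext; intros k; rewrite Hg0; unfold g, scal; simpl.
  unfold mult; simpl; field; specialize (Htj j); lra.
- assert (Hn := fubini_norm (V := R_CompleteNormedModule) g Hg).
  revert Hn; apply ex_series_ext; intros j.
  rewrite <- Series_scal_l; apply Series_ext; intros k; apply Hg0.
Qed.

(** Naming the terms fixes the module in which they live, which [scal] alone leaves ambiguous
    to unification. *)
Definition dterm {V : NormedModule C_AbsRing} (b : nat -> V) (z : C) (k : nat) : V :=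
  scal (dpow k z) (b k).

Section PowerSeries.
Context {V : CompleteNormedModule C_AbsRing}.

Lemma norm_dterm (b : nat -> V) (z : C) (k : nat) :
  norm (dterm b z k) <= rdpow k (Cmod z) * norm (b k).
Proof.
rewrite <- Cmod_dpow; exact (norm_scal (K := C_AbsRing) (dpow k z) (b k)).
Qed.

Lemma sum_n_scal_l (c : nat -> C) (w : V) (n : nat) :
  sum_n (fun j => scal (c j) w) n = scal (sum_n c n) w.
Proof.
induction n as [| n IH]; [now rewrite !sum_O |].
rewrite !sum_Sn, IH; symmetry; exact (scal_distr_r (K := C_Ring) _ _ _).
Qed.

(** Fubini for [e_j(y) e_k(x) b_{j+k}]: by the binomial formula the [m]-th
    diagonal is [e_m(x + y) b_m]. *)
Lemma dpow_reexpand (b : nat -> V) (row : nat -> V) (x y : C) (s t : R) (l : V) :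
  Cmod x <= s -> Cmod y <= t ->
  ex_series (fun m => rdpow m (s + t) * norm (b m)) ->
  (forall j, is_series (dterm (fun k => b (j + k)%nat) x) (row j)) ->
  is_series (dterm b (x + y)%C) l ->
  is_series (dterm row y) l.
Proof.
intros Hx Hy Hb Hrow Hl.
assert (Hx0 := Cmod_ge_0 x); assert (Hy0 := Cmod_ge_0 y).
apply rdpow_double_series in Hb; [| intros; apply norm_ge_0 | lra | lra].
set (g := fun j k => dterm (fun j => dterm (fun k => b (j + k)%nat) x k) y j).
apply (fubini (V := V) g).
- revert Hb; apply ex_series_le_R; intros m; split.
  + apply sum_n_ge0; intros j; apply norm_ge_0.
  + apply sum_n_le_loc; intros j _; unfold g.
    apply Rle_trans with (1 := norm_dterm _ _ _).
    apply Rmult_le_compat; [now apply rdpow_ge0 | apply norm_ge_0 | now apply rdpow_le |].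
    apply Rle_trans with (1 := norm_dterm _ _ _).
    apply Rmult_le_compat_r; [apply norm_ge_0 | now apply rdpow_le].
- intros j; exact (is_series_scal (V := V) (dpow j y) _ _ (Hrow j)).
- revert Hl; apply is_series_ext; intros m.
  unfold dterm at 1; rewrite <- dpow_binomial.
  transitivity (sum_n (fun j => scal (Cmult (dpow j y) (dpow (m - j) x)) (b m)) m).
  + symmetry; apply sum_n_scal_l.
  + apply sum_n_ext_loc; intros j Hj; unfold g.
    unfold dterm; replace (j + (m - j))%nat with m by lia.
    symmetry; exact (scal_assoc (K := C_Ring) (dpow j y) (dpow (m - j) x) (b m)).
Qed.
End PowerSeries.

(** * Taylor remainder and uniqueness of coefficients *)

(** The sum of the first [n] terms, unlike [sum_n], may be empty. *)
Fixpoint psum {G : AbelianMonoid} (a : nat -> G) (n : nat) : G :=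
  match n with O => zero | S n => plus (psum a n) (a n) end.

Lemma psum_S {G : AbelianMonoid} (a : nat -> G) (n : nat) :
  psum a (S n) = sum_n a n.
Proof.
induction n as [| n IH].
- rewrite sum_O; apply plus_zero_l.
- now rewrite sum_Sn, <- IH.
Qed.

Lemma psum_ext {G : AbelianMonoid} (a b : nat -> G) (n : nat) :
  (forall k, (k < n)%nat -> a k = b k) -> psum a n = psum b n.
Proof.
induction n as [| n IH]; intros H; [easy |]; simpl.
rewrite IH by (intros; apply H; lia); now rewrite H by lia.
Qed.

Section Taylor.
Context {V : NormedModule C_AbsRing}.

Lemma Cmod_norm_le_scal (c : C) (v : V) : Cmod c * norm v <= norm (scal c v).
Proof.
destruct (Req_dec (Cmod c) 0) as [H | H].
{ rewrite H, Rmult_0_l; apply norm_ge_0. }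
assert (Hc : c <> 0%C) by (intros ->; apply H, Cmod_0).
assert (Hp : 0 < Cmod c) by now apply Cmod_gt_0.
assert (E : v = scal (Cinv c) (scal c v)).
{ rewrite (scal_assoc (K := C_Ring)).
  change (v = scal (Cinv c * c)%C v).
  rewrite Cinv_l by exact Hc; symmetry; exact (scal_one (K := C_Ring) v). }
assert (H1 : norm v <= Cmod (Cinv c) * norm (scal c v)).
{ apply Rle_trans with (norm (scal (Cinv c) (scal c v))).
  - right; f_equal; exact E.
  - exact (norm_scal (K := C_AbsRing) (Cinv c) (scal c v)). }
rewrite Cmod_inv in H1 by exact Hc.
apply (Rmult_le_compat_l (Cmod c)) in H1; [| lra].
rewrite <- Rmult_assoc, Rinv_r, Rmult_1_l in H1 by exact H; exact H1.
Qed.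

Lemma series_terms_bounded (a : nat -> V) (l : V) :
  is_series a l -> exists M, forall n, norm (a n) <= M.
Proof.
intros H.
destruct (filterlim_bounded (V := V) (sum_n a)) as [M HM]; [now exists l |].
exists (2 * M); intros [| n].
- specialize (HM 0%nat); rewrite sum_O in HM.
  assert (H0 := norm_ge_0 (a 0%nat)); lra.
- assert (E : a (S n) = minus (sum_n a (S n)) (sum_n a n)).
  { rewrite sum_Sn; unfold minus.
    rewrite (plus_comm (sum_n a n)), <- plus_assoc.
    change (a (S n) = plus (a (S n)) (minus (sum_n a n) (sum_n a n))).
    now rewrite minus_eq_zero, plus_zero_r. }
  rewrite E.
  apply Rle_trans with (1 := norm_triangle _ _); rewrite norm_opp.
  assert (H1 := HM n); assert (H2 := HM (S n)); lra.
Qed.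

(** The terms are dominated by [M q^i] with [q = |z| / rho <= 1/2], a geometric
    series whose tail is at most twice its first term. *)
Lemma taylor_remainder (b : nat -> V) (M rho : R) (z : C) (l : V) (k : nat) :
  0 < rho -> (forall i, rdpow i rho * norm (b i) <= M) ->
  Cmod z <= rho / 2 ->
  is_series (dterm b z) l ->
  norm (minus l (psum (dterm b z) k))
    <= 2 * M * (Cmod z / rho) ^ k.
Proof.
intros Hrho HM Hz Hl.
assert (Hz0 := Cmod_ge_0 z).
set (q := Cmod z / rho).
assert (Hq : 0 <= q <= / 2).
{ unfold q; split.
  - apply Rmult_le_pos; [exact Hz0 | now apply Rlt_le, Rinv_0_lt_compat].
  - apply Rmult_le_reg_r with rho; [exact Hrho |].
    unfold Rdiv; rewrite Rmult_assoc, Rinv_l by lra; lra. }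
assert (HM0 : 0 <= M).
{ apply Rle_trans with (2 := HM 0%nat).
  apply Rmult_le_pos; [apply rdpow_ge0; lra | apply norm_ge_0]. }
set (a := dterm b z) in *.
assert (Ha : forall i, norm (a i) <= M * q ^ i).
{ intros i.
  apply Rle_trans with (rdpow i (Cmod z) * norm (b i)).
  { rewrite <- Cmod_dpow; exact (norm_scal (K := C_AbsRing) (dpow i z) (b i)). }
  replace (rdpow i (Cmod z)) with (q ^ i * rdpow i rho).
  - rewrite Rmult_assoc, (Rmult_comm M); apply Rmult_le_compat_l; [| apply HM].
    now apply pow_le.
  - unfold rdpow, q, Rdiv; rewrite Rpow_mult_distr, pow_inv; field.
    split; [apply INR_fact_neq_0 | apply pow_nonzero; lra]. }
(* [2 M (q^k - q^(n+k))] dominates the partial sums because [q <= 1/2] makes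
   each step [2 M (q^m - q^(m+1))] at least [M q^m] *)
assert (Hn : forall n, norm (minus (psum a (n + k)) (psum a k))
                       <= 2 * M * (q ^ k - q ^ (n + k))).
{ induction n as [| n IH]; simpl.
  - eapply Rle_trans; [right; exact (norm_minus_self (psum a k)) | lra].
  - apply Rle_trans with (norm (minus (psum a (n + k)) (psum a k)) + norm (a (n + k)%nat)).
    + exact (norm_minus_plus_l (psum a (n + k)) (psum a k) (a (n + k)%nat)).
    + specialize (Ha (n + k)%nat).
      assert (Hp : 0 <= M * q ^ (n + k)) by (apply Rmult_le_pos; [lra | apply pow_le; lra]).
      assert (Hpq : (M * q ^ (n + k)) * q <= (M * q ^ (n + k)) * / 2)
        by (apply Rmult_le_compat_l; lra).
      lra. }
apply (norm_limit_le (V := V)) with (f := sum_n a); [now apply is_series_eps |].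
exists k; intros n Hk.
rewrite <- psum_S.
replace (S n) with ((S n - k) + k)%nat by lia.
apply Rle_trans with (1 := Hn _).
apply Rmult_le_compat_l; [lra |].
assert (0 <= q ^ (S n - k + k)) by (apply pow_le; lra); lra.
Qed.

Lemma dpow_coef_bounded (b : nat -> V) (r : R) (l : V) :
  0 < r -> is_series (dterm b (RtoC r)) l ->
  exists M, forall i, rdpow i r * norm (b i) <= M.
Proof.
intros Hr H; apply series_terms_bounded in H; destruct H as [M HM].
exists M; intros i; apply Rle_trans with (2 := HM i).
apply Rle_trans with (2 := Cmod_norm_le_scal _ _).
rewrite Cmod_dpow, Cmod_R, Rabs_pos_eq by lra; lra.
Qed.

(** The [k]-th coefficient is a limit of difference quotients that involve [f] and
    only the earlier coefficients.  Real [u > 0] suffice: the functions expanded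
    below are defined on the real line. *)
Lemma dpow_coef_limit (b : nat -> V) (f : R -> V) (r : R) (k : nat) :
  0 < r ->
  (forall u, Rabs u < r -> is_series (dterm b (RtoC u)) (f u)) ->
  forall eps, 0 < eps -> exists delta, 0 < delta /\
    forall u, 0 < u < delta ->
      norm (minus (scal (Cinv (dpow k (RtoC u)))
                     (minus (f u) (psum (dterm b (RtoC u)) k)))
              (b k)) < eps.
Proof.
intros Hr Hf eps Heps.
set (rho := r / 2).
assert (Hrho : 0 < rho) by (unfold rho; lra).
destruct (dpow_coef_bounded b rho (f rho) Hrho) as [M HM].
{ apply Hf; rewrite Rabs_pos_eq; unfold rho; lra. }
assert (HM0 : 0 <= M).
{ apply Rle_trans with (2 := HM 0%nat).
  apply Rmult_le_pos; [apply rdpow_ge0; lra | apply norm_ge_0]. }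
set (c := 2 * M * INR (fact k) / rho ^ (S k)).
assert (Hc : 0 <= c).
{ apply Rmult_le_pos; [| apply Rlt_le, Rinv_0_lt_compat; now apply pow_lt].
  apply Rmult_le_pos; [lra | apply pos_INR]. }
exists (Rmin (rho / 2) (eps / (c + 1))); split.
{ apply Rmin_glb_lt; [lra | apply Rdiv_lt_0_compat; lra]. }
intros u [Hu Hu'].
assert (Hu1 : u < rho / 2) by (apply Rlt_le_trans with (1 := Hu'), Rmin_l).
assert (Hu2 : u < eps / (c + 1)) by (apply Rlt_le_trans with (1 := Hu'), Rmin_r).
assert (HT := taylor_remainder b M rho (RtoC u) (f u) (S k) Hrho HM).
rewrite Cmod_R, Rabs_pos_eq in HT by lra.
specialize (HT ltac:(lra)).
specialize (HT (Hf u ltac:(rewrite Rabs_pos_eq; unfold rho in *; lra))).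
set (d := dpow k (RtoC u)) in *.
assert (Hd : Cmod d = rdpow k u).
{ unfold d; rewrite Cmod_dpow, Cmod_R, Rabs_pos_eq; lra. }
assert (Hdp : 0 < rdpow k u) by now apply rdpow_gt0.
assert (Hd0 : d <> 0%C) by (apply Cmod_gt_0; lra).
simpl psum in HT; fold d in HT.
set (p := psum (dterm b (RtoC u)) k) in *.
assert (E : minus (scal (Cinv d) (minus (f u) p)) (b k)
            = scal (Cinv d) (minus (f u) (plus p (scal d (b k))))).
{ assert (Eb : b k = scal (Cinv d) (scal d (b k))).
  { rewrite (scal_assoc (K := C_Ring)); change (b k = scal (Cinv d * d)%C (b k)).
    rewrite Cinv_l by exact Hd0; symmetry; exact (scal_one (K := C_Ring) (b k)). }
  rewrite Eb at 1.
  transitivity (scal (Cinv d) (minus (minus (f u) p) (scal d (b k)))).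
  - symmetry; exact (scal_minus_distr_l (K := C_Ring) (Cinv d) _ _).
  - f_equal; symmetry; exact (minus_plus_r (f u) p (scal d (b k))). }
rewrite E.
apply Rle_lt_trans with (1 := norm_scal (K := C_AbsRing) _ _).
change (Cmod (Cinv d) * norm (minus (f u) (plus p (scal d (b k)))) < eps).
rewrite Cmod_inv by exact Hd0; rewrite Hd.
apply Rle_lt_trans with (/ rdpow k u * (2 * M * (u / rho) ^ S k)).
{ apply Rmult_le_compat_l; [now apply Rlt_le, Rinv_0_lt_compat | exact HT]. }
replace (/ rdpow k u * (2 * M * (u / rho) ^ S k)) with (c * u).
- apply Rle_lt_trans with ((c + 1) * u); [lra |].
  apply (Rmult_lt_compat_l (c + 1)) in Hu2; [| lra].
  replace ((c + 1) * (eps / (c + 1))) with eps in Hu2 by (field; lra); exact Hu2.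
- unfold c, rdpow, Rdiv; rewrite Rpow_mult_distr, pow_inv.
  replace (u ^ S k) with (u * u ^ k) by reflexivity; field.
  repeat split; try apply INR_fact_neq_0; apply pow_nonzero; lra.
Qed.

(** Strong induction on [k]: the quotients in [dpow_coef_limit] are then the same for both
    expansions. *)
Lemma dpow_coef_unique (b b' : nat -> V) (f : R -> V) (r : R) :
  0 < r ->
  (forall u, Rabs u < r -> is_series (dterm b (RtoC u)) (f u)) ->
  (forall u, Rabs u < r -> is_series (dterm b' (RtoC u)) (f u)) ->
  forall k, b k = b' k.
Proof.
intros Hr Hb Hb' k; induction k as [k IH] using (well_founded_induction Wf_nat.lt_wf).
apply ball_norm_eq; intros [e He]; unfold ball_norm; simpl.
destruct (dpow_coef_limit b f r k Hr Hb (e / 2) ltac:(lra)) as [d1 [Hd1 H1]].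
destruct (dpow_coef_limit b' f r k Hr Hb' (e / 2) ltac:(lra)) as [d2 [Hd2 H2]].
set (u := Rmin d1 d2 / 2).
assert (Hu : 0 < Rmin d1 d2) by now apply Rmin_glb_lt.
assert (Hl := Rmin_l d1 d2); assert (Hr' := Rmin_r d1 d2).
specialize (H1 u ltac:(unfold u; lra)); specialize (H2 u ltac:(unfold u; lra)).
rewrite (psum_ext _ (dterm b' (RtoC u))) in H1
  by (intros i Hi; unfold dterm; now rewrite IH).
replace e with (e / 2 + e / 2) by lra.
eapply Rle_lt_trans; [eapply norm_minus_triangle |].
apply Rplus_lt_compat;
  [eapply Rle_lt_trans; [right; apply norm_minus_sym | exact H2] | exact H1].
Qed.
End Taylor.

(** * Limits of bounded operators and Baire's theorem *)

Section OperatorLimits.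
Context {X : NormedModule C_AbsRing}.

Lemma sum_n_op (A : nat -> bounded_op X) (n : nat) (x : X) :
  (sum_n A n : bounded_op X) x = sum_n (fun k => A k x) n.
Proof.
induction n as [| n IH]; [now rewrite !sum_O |].
rewrite !sum_Sn, <- IH; reflexivity.
Qed.

Lemma psum_op (A : nat -> bounded_op X) (n : nat) (x : X) :
  (psum A n : bounded_op X) x = psum (fun k => A k x) n.
Proof.
induction n as [| n IH]; [reflexivity |].
simpl; rewrite <- IH; reflexivity.
Qed.

Lemma op_limit (Q : nat -> bounded_op X) (b : X -> X) (M : R) :
  0 <= M -> (forall n, op_norm (Q n) <= M) ->
  (forall x, filterlim (fun n => Q n x) eventually (locally (b x))) ->
  exists A : bounded_op X, (forall x, A x = b x) /\ op_norm A <= M.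
Proof.
intros HM HQ Hb.
assert (Hn : forall x, norm (b x) <= M * norm x).
{ intros x.
  apply (is_lim_seq_le (fun n => norm (Q n x)) (fun _ => M * norm x)
           (norm (b x)) (M * norm x)).
  - intros n; apply Rle_trans with (1 := op_norm_bound (Q n) x).
    apply Rmult_le_compat_r; [apply norm_ge_0 | apply HQ].
  - exact (filterlim_comp _ _ _ _ _ _ _ _ (Hb x) (filterlim_norm (b x))).
  - apply is_lim_seq_const. }
assert (Hlin : is_linear b).
{ split.
  - intros x y.
    apply (filterlim_locally_unique (F := eventually) (fun n => Q n (plus x y)));
      [apply Hb |].
    apply filterlim_ext with (fun n => plus (Q n x) (Q n y)).
    { intros n; symmetry; apply (linear_plus _ (op_linear (Q n))). }
    eapply filterlim_comp_2; [exact (Hb x) | exact (Hb y) |].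
    exact (filterlim_plus (b x) (b y)).
  - intros k x.
    apply (filterlim_locally_unique (F := eventually) (fun n => Q n (scal k x)));
      [apply Hb |].
    apply filterlim_ext with (fun n => scal k (Q n x)).
    { intros n; symmetry; apply (linear_scal _ (op_linear (Q n))). }
    exact (filterlim_comp _ _ _ _ _ _ _ _ (Hb x) (filterlim_scal_r k (b x))).
  - exists (M + 1); split; [lra |]; intros x.
    apply Rle_trans with (1 := Hn x); apply Rmult_le_compat_r; [apply norm_ge_0 | lra]. }
exists (BoundedOp Hlin); split; [easy |].
apply op_norm_le; [exact HM | exact Hn].
Qed.

Lemma op_series_apply (A : bounded_op X) (a : nat -> X) (l : X) :
  is_series a l -> is_series (fun k => A (a k)) (A l).
Proof.
intros H.
apply filterlim_ext with (fun n => A (sum_n a n)).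
{ intros n; induction n as [| n IH]; [now rewrite !sum_O |].
  rewrite !sum_Sn, <- IH; apply (linear_plus _ (op_linear A)). }
apply filterlim_comp with (1 := H).
exact (linear_cont _ _ (op_linear A)).
Qed.

Lemma op_dterm (A : bounded_op X) (b : nat -> X) (z : C) (l : X) :
  is_series (dterm b z) l -> is_series (dterm (fun k => A (b k)) z) (A l).
Proof.
intros H; apply (op_series_apply A) in H; revert H; apply is_series_ext.
intros k; apply (linear_scal _ (op_linear A)).
Qed.

Lemma op_norm_comp (A B : bounded_op X) :
  op_norm (op_comp A B) <= op_norm A * op_norm B.
Proof.
assert (HA := op_norm_ge0 A); assert (HB := op_norm_ge0 B).
apply op_norm_le; [now apply Rmult_le_pos |]; intros x; simpl.
apply Rle_trans with (1 := op_norm_bound A (B x)).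
rewrite Rmult_assoc; apply Rmult_le_compat_l; [exact HA | apply op_norm_bound].
Qed.
End OperatorLimits.

Section Baire.
Context {X : CompleteNormedModule C_AbsRing}.

(** The sum is taken pointwise, in the complete space [X]; it is bounded because the
    partial sums are bounded uniformly. *)
Lemma op_dseries (A : nat -> bounded_op X) (z : C) (r : R) :
  Cmod z <= r -> ex_series (fun k => rdpow k r * op_norm (A k)) ->
  exists S : bounded_op X,
    (forall x, is_series (dterm (fun k => A k x) z) (S x)) /\
    op_norm S <= Series (fun k => rdpow k r * op_norm (A k)).
Proof.
intros Hz Hr.
assert (Hz0 := Cmod_ge_0 z).
assert (Hle : forall k, rdpow k (Cmod z) <= rdpow k r) by (intros; now apply rdpow_le).
assert (Hpos : forall k, 0 <= rdpow k r * op_norm (A k)).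
{ intros k; apply Rmult_le_pos; [apply rdpow_ge0; lra | apply op_norm_ge0]. }
assert (Hex : forall x : X, exists l : X, is_series (dterm (fun k => A k x) z) l).
{ intros x.
  apply (ex_series_le (V := X) _
           (fun k => rdpow k r * op_norm (A k) * norm x)).
  - intros k; apply Rle_trans with (1 := norm_dterm _ _ _).
    rewrite Rmult_assoc; apply Rmult_le_compat;
      [now apply rdpow_ge0 | apply norm_ge_0 | apply Hle | apply op_norm_bound].
  - apply (ex_series_scal_r (norm x) _ Hr). }
set (b := fun x => proj1_sig (constructive_indefinite_description _ (Hex x))).
assert (Hb : forall x, is_series (dterm (fun k => A k x) z) (b x)).
{ intros x; exact (proj2_sig (constructive_indefinite_description _ (Hex x))). }
destruct (op_limit (sum_n (fun k => op_scal (dpow k z) (A k))) b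
           (Series (fun k => rdpow k r * op_norm (A k)))) as [S [HS HSn]].
- apply Rle_trans with (sum_n (fun k => rdpow k r * op_norm (A k)) 0).
  + now apply sum_n_ge0.
  + apply sum_n_le_series; [exact Hpos | now apply Series_correct].
- intros n; apply Rle_trans with (sum_n (fun k => rdpow k r * op_norm (A k)) n).
  + apply Rle_trans with (1 := norm_sum_n (V := op_NormedModule X) _ n).
    apply sum_n_le_loc; intros k _.
    apply Rle_trans with (1 := op_norm_scal _ _).
    rewrite Cmod_dpow; apply Rmult_le_compat_r; [apply op_norm_ge0 | apply Hle].
  + apply sum_n_le_series; [exact Hpos | now apply Series_correct].
- intros x; apply filterlim_ext with (2 := Hb x); intros n.
  symmetry; exact (sum_n_op (fun k => op_scal (dpow k z) (A k)) n x).
- exists S; split; [| exact HSn]; intros x; rewrite HS; apply Hb.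
Qed.

(** Closedness with respect to the norm. *)
Definition rel_closed (E : X -> Prop) : Prop :=
  forall x, ~ E x -> exists r, 0 < r /\ forall y, norm (minus y x) < r -> ~ E y.

(** If no [E n] contains a ball, every ball contains one of at most half its radius
    that misses [E n].  The centres of the resulting nested balls converge to a point
    that lies in none of the [E n]. *)
Lemma baire (E : nat -> X -> Prop) :
  (forall n, rel_closed (E n)) -> (forall x, exists n, E n x) ->
  exists n x0 r, 0 < r /\ forall y, norm (minus y x0) < r -> E n y.
Proof.
intros Hcl Hcov; apply NNPP; intros Hno.
assert (Hstep : forall n (p : X * R), exists q : X * R, 0 < snd p ->
   0 < snd q <= snd p / 2 /\ norm (minus (fst q) (fst p)) <= snd p / 2 /\
   forall y, norm (minus y (fst q)) <= snd q -> ~ E n y).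
{ intros n [x r]; simpl.
  destruct (Rlt_dec 0 r) as [Hr | Hr]; [| exists (x, r); intros; contradiction].
  assert (Hy : exists y, norm (minus y x) < r / 2 /\ ~ E n y).
  { apply NNPP; intros H; apply Hno; exists n, x, (r / 2); split; [lra |].
    intros y Hy; apply NNPP; intros HE; apply H; now exists y. }
  destruct Hy as [y [Hy HE]].
  destruct (Hcl n y HE) as [s [Hs Hball]].
  exists (y, Rmin (s / 2) (r / 2)); simpl; intros _.
  assert (H1 := Rmin_l (s / 2) (r / 2)); assert (H2 := Rmin_r (s / 2) (r / 2)).
  assert (H3 : 0 < Rmin (s / 2) (r / 2)) by (apply Rmin_glb_lt; lra).
  repeat split; try lra.
  intros w Hw; apply Hball; lra. }
(* a state is a centre with a positive radius; [step n] shrinks it away from [E n] *)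
set (step := fun n p => proj1_sig (constructive_indefinite_description _ (Hstep n p))).
assert (Hst : forall n p, 0 < snd p ->
   0 < snd (step n p) <= snd p / 2 /\ norm (minus (fst (step n p)) (fst p)) <= snd p / 2 /\
   forall y, norm (minus y (fst (step n p))) <= snd (step n p) -> ~ E n y).
{ intros n p; exact (proj2_sig (constructive_indefinite_description _ (Hstep n p))). }
clearbody step.
set (seq := fix seq n := match n with O => (zero : X, 1) | S n => step n (seq n) end).
assert (Hpos : forall n, 0 < snd (seq n)).
{ induction n as [| n IH]; simpl; [lra | now apply Hst]. }
assert (Hgeo : forall n, snd (seq n) <= (/ 2) ^ n).
{ induction n as [| n IH]; simpl; [lra |].
  assert (H := proj1 (Hst n (seq n) (Hpos n))); lra. }
(* radii are at least halved at each step, so the distances [<= snd (seq n) / 2]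
   between consecutive centres telescope *)
assert (Hnest : forall n m, norm (minus (fst (seq (m + n)%nat)) (fst (seq n)))
                            <= snd (seq n) - snd (seq (m + n)%nat)).
{ intros n m; induction m as [| m IH]; simpl.
  - rewrite (norm_minus_self (V := X)); lra.
  - destruct (Hst (m + n)%nat (seq (m + n)%nat) (Hpos _)) as [H1 [H2 _]].
    eapply Rle_trans;
      [exact (norm_minus_triangle (V := X) _ (fst (seq (m + n)%nat)) _) |].
    eapply Rle_trans; [exact (Rplus_le_compat _ _ _ _ H2 IH) | lra]. }
assert (Hlim : exists x : X, forall eps, 0 < eps -> exists N, forall n, (N <= n)%nat ->
   norm (minus (fst (seq n)) x) < eps).
{ destruct (ex_series_le (V := X) (fun n => minus (fst (seq (S n))) (fst (seq n)))
             (fun n => (/ 2) ^ n)) as [l Hl].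
  - intros n; assert (H := Hnest n 1%nat); assert (H0 := Hgeo n).
    assert (H1 := Hpos (1 + n)%nat).
    apply Rle_trans with (1 := H); lra.
  - exists (/ (1 - / 2)); apply is_series_geom; rewrite Rabs_pos_eq; lra.
  - exists l; intros eps Heps.
    destruct (proj1 (is_series_eps _ _) Hl eps Heps) as [N HN].
    exists (S N); intros [| n] Hn; [lia |].
    specialize (HN n ltac:(lia)).
    eapply Rle_lt_trans; [right | exact HN]; do 2 f_equal.
    symmetry; etransitivity; [exact (sum_n_telescope (G := X) (fun n => fst (seq n)) n) |].
    exact (minus_zero_r (G := X) (fst (seq (S n)))). }
destruct Hlim as [x Hx].
destruct (Hcov x) as [n HE]; revert HE.
apply (Hst n (seq n) (Hpos n)).
change (norm (minus x (fst (seq (S n)))) <= snd (seq (S n))).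
apply norm_limit_le with (fun m => fst (seq m)); [exact Hx |].
exists (S n); intros m Hm.
replace m with ((m - S n) + S n)%nat by lia.
apply Rle_trans with (1 := Hnest (S n) (m - S n)%nat).
assert (H := Hpos (m - S n + S n)%nat); lra.
Qed.

Lemma op_norm_closed (A : bounded_op X) (M : R) :
  rel_closed (fun x => norm (A x) <= M).
Proof.
intros x Hx; apply Rnot_le_lt in Hx.
assert (HA := op_norm_ge0 A).
exists ((norm (A x) - M) / (op_norm A + 1)); split.
{ apply Rdiv_lt_0_compat; lra. }
intros y Hy; apply Rlt_not_le.
assert (H1 : norm (minus (A y) (A x)) <= op_norm A * norm (minus y x)).
{ apply Rle_trans with (2 := op_norm_bound A (minus y x)); right; f_equal.
  unfold minus; rewrite (linear_plus _ (op_linear A)); f_equal.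
  symmetry; apply (linear_opp _ _ (op_linear A)). }
assert (H2 : norm (A x) <= norm (minus (A y) (A x)) + norm (A y)).
{ rewrite (norm_minus_sym (V := X)).
  apply Rle_trans with (2 := norm_triangle _ _); right; f_equal.
  exact (plus_minus_cancel (G := X) (A x) (A y)). }
assert (H3 : (op_norm A + 1) * norm (minus y x) < norm (A x) - M).
{ apply (Rmult_lt_compat_l (op_norm A + 1)) in Hy; [| lra].
  replace ((op_norm A + 1) * ((norm (A x) - M) / (op_norm A + 1)))
    with (norm (A x) - M) in Hy by (field; lra); exact Hy. }
assert (H4 := norm_ge_0 (minus y x)); lra.
Qed.

Lemma rel_closed_forall {I : Type} (E : I -> X -> Prop) :
  (forall i, rel_closed (E i)) -> rel_closed (fun x => forall i, E i x).
Proof.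
intros H x Hx; apply not_all_ex_not in Hx; destruct Hx as [i Hi].
destruct (H i x Hi) as [r [Hr Hball]].
exists r; split; [exact Hr |]; intros y Hy Hall; exact (Hball y Hy (Hall i)).
Qed.

(** A vector [x] of norm at most [1] is a multiple of the difference of the two
    points [x0 + (r/2) x] and [x0] of the ball, which costs the factor
    [2 * 2 / r]. *)
Lemma op_norm_le_of_ball (A : bounded_op X) (x0 : X) (r w : R) :
  0 < r -> (forall y, norm (minus y x0) < r -> norm (A y) <= w) ->
  op_norm A <= 4 / r * w.
Proof.
intros Hr Hball.
apply (proj2 (op_norm_lub A) (Finite (4 / r * w))).
intros v [x [Hx ->]]; simpl.
set (c := RtoC (r / 2)).
assert (Hc : Cmod c = r / 2) by (unfold c; rewrite Cmod_R, Rabs_pos_eq; lra).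
assert (Hy : norm (minus (plus x0 (scal c x)) x0) < r).
{ apply Rle_lt_trans with (norm (scal c x)).
  - right; f_equal; exact (minus_plus_l (G := X) x0 (scal c x)).
  - apply Rle_lt_trans with (1 := norm_scal (K := C_AbsRing) c x).
    change (Cmod c * norm x < r); rewrite Hc.
    apply Rle_lt_trans with (r / 2 * 1); [apply Rmult_le_compat_l; lra | lra]. }
assert (H1 := Hball _ Hy).
assert (Hx0 : norm (minus x0 x0) < r).
{ apply Rle_lt_trans with 0; [right; exact (norm_minus_self (V := X) x0) | exact Hr]. }
assert (H2 := Hball _ Hx0).
assert (H3 : norm (scal c (A x)) <= 2 * w).
{ apply Rle_trans with (norm (minus (A (plus x0 (scal c x))) (A x0))).
  - right; f_equal; rewrite (linear_plus _ (op_linear A)).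
    rewrite (linear_scal _ (op_linear A)).
    symmetry; exact (minus_plus_l (G := X) (A x0) (scal c (A x))).
  - apply Rle_trans with (1 := norm_triangle _ _); rewrite norm_opp; lra. }
assert (H4 := Cmod_norm_le_scal c (A x)); rewrite Hc in H4.
apply Rmult_le_reg_l with (r / 2); [lra |].
replace (r / 2 * (4 / r * w)) with (2 * w) by (field; lra); lra.
Qed.

(** The uniform boundedness principle for a family of growth rates [w n], the rate
    being allowed to depend on the vector. *)
Lemma uniform_growth (A : nat -> bounded_op X) (w : nat -> nat -> R) :
  (forall x, exists n, forall k, norm (A k x) <= w n k) ->
  exists n M, 0 <= M /\ forall k, op_norm (A k) <= M * w n k.
Proof.
intros H.
destruct (baire (fun n x => forall k, norm (A k x) <= w n k)) as [n [x0 [r [Hr Hball]]]].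
- intros n; apply rel_closed_forall; intros k; apply op_norm_closed.
- exact H.
- exists n, (4 / r); split.
  { apply Rmult_le_pos; [lra | now apply Rlt_le, Rinv_0_lt_compat]. }
  intros k; apply op_norm_le_of_ball with x0; [exact Hr |].
  intros y Hy; now apply Hball.
Qed.

(** Convergent sequences are bounded, so [uniform_growth] applies with constant rates. *)
Lemma banach_steinhaus_limit (Q : nat -> bounded_op X) (b : X -> X) :
  (forall x, filterlim (fun n => Q n x) eventually (locally (b x))) ->
  exists A : bounded_op X, forall x, A x = b x.
Proof.
intros H.
destruct (uniform_growth Q (fun n _ => INR n)) as [n [M [HM HQ]]].
- intros x; destruct (filterlim_bounded (V := X) (fun n => Q n x)) as [B HB].
  { exists (b x); apply H. }
  destruct (nfloor_ex (Rmax B 0) (Rmax_r _ _)) as [n [_ Hn]].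
  exists (S n); intros k; apply Rle_trans with (1 := HB k).
  rewrite S_INR; assert (H1 := Rmax_l B 0); lra.
- destruct (op_limit Q b (M * INR n)) as [A [HA _]]; [| exact HQ | exact H | now exists A].
  apply Rmult_le_pos; [exact HM | apply pos_INR].
Qed.
End Baire.

(** * From analytic orbits to analyticity in operator norm *)

Lemma pow_n_Cpow (z : C) (k : nat) : pow_n (K := C_Ring) z k = (z ^ k)%C.
Proof.
induction k as [| k IH]; [reflexivity |].
rewrite Cpow_S, <- IH; reflexivity.
Qed.

Section NormAnalytic.
Context {X : CompleteNormedModule C_AbsRing}.

Lemma is_pseries_dterm (a : nat -> X) (z : C) (l : X) :
  is_pseries a z l ->
  is_series (dterm (fun k => scal (RtoC (INR (fact k))) (a k)) z) l.
Proof.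
apply is_series_ext; intros k; unfold dterm.
etransitivity; [| symmetry; exact (scal_assoc (K := C_Ring) _ _ (a k))].
apply (f_equal (fun c : C => scal c (a k))).
etransitivity; [exact (pow_n_Cpow z k) |].
change (z ^ k = dpow k z * RtoC (INR (fact k)))%C.
unfold dpow; field; apply fact_C_neq0.
Qed.

Variable F : R -> bounded_op X.

(** By strong induction the difference quotient of [dpow_coef_limit] is, for
    fixed [u], a bounded operator applied to [x]; let [u = 1/(n+1)] tend to [0]. *)
Lemma coefficients_bounded (b : X -> nat -> X) (r : X -> R) :
  (forall x, 0 < r x) ->
  (forall x u, Rabs u < r x -> is_series (dterm (b x) (RtoC u)) (F u x)) ->
  exists D : nat -> bounded_op X, forall k x, D k x = b x k.
Proof.
intros Hr Hb.
enough (H : forall k, exists A : bounded_op X, forall x, A x = b x k).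
{ exists (fun k => proj1_sig (constructive_indefinite_description _ (H k))).
  intros k; exact (proj2_sig (constructive_indefinite_description _ (H k))). }
induction k as [k IH] using (well_founded_induction Wf_nat.lt_wf).
assert (HA : forall i, exists A : bounded_op X, (i < k)%nat -> forall x, A x = b x i).
{ intros i; destruct (Compare_dec.lt_dec i k) as [Hi | Hi].
  - destruct (IH i Hi) as [A HA]; now exists A.
  - exists (op_zero X); intros; contradiction. }
set (A := fun i => proj1_sig (constructive_indefinite_description _ (HA i))).
assert (HA' : forall i, (i < k)%nat -> forall x, A i x = b x i).
{ intros i; exact (proj2_sig (constructive_indefinite_description _ (HA i))). }
clearbody A; clear HA.
set (u := fun n => / INR (S n)).
set (Q := fun n => op_scal (Cinv (dpow k (RtoC (u n))))
   (op_plus (F (u n)) (op_opp (psum (fun i => op_scal (dpow i (RtoC (u n))) (A i)) k)))).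
apply (banach_steinhaus_limit Q); intros x.
apply (filterlim_locally_ball_norm (U := X)); intros [e He].
destruct (dpow_coef_limit (b x) (fun u => F u x) (r x) k (Hr x) (Hb x) e He)
  as [d [Hd Hlim]].
destruct (nfloor_ex (/ d)) as [N [_ HN]]; [now apply Rlt_le, Rinv_0_lt_compat |].
exists N; intros n Hn; change (norm (minus (Q n x) (b x k)) < e).
assert (Hu : 0 < u n < d).
{ unfold u; split; [apply Rinv_0_lt_compat, lt_0_INR; lia |].
  rewrite <- (Rinv_inv d); apply Rinv_lt_contravar.
  - apply Rmult_lt_0_compat; [now apply Rinv_0_lt_compat | apply lt_0_INR; lia].
  - apply Rlt_le_trans with (1 := HN); rewrite <- S_INR; apply le_INR; lia. }
assert (E : (psum (fun i => op_scal (dpow i (RtoC (u n))) (A i)) k : bounded_op X) x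
            = psum (dterm (b x) (RtoC (u n))) k).
{ etransitivity; [exact (psum_op _ k x) |].
  apply psum_ext; intros i Hi; unfold dterm; simpl; now rewrite HA'. }
assert (E' : Q n x = scal (Cinv (dpow k (RtoC (u n))))
   (minus (F (u n) x) (psum (dterm (b x) (RtoC (u n))) k))).
{ rewrite <- E; reflexivity. }
rewrite E'; exact (Hlim (u n) Hu).
Qed.

(** Convergence for each [x] bounds the coefficients of [x] by [n n^k k!] for some
    [n]; one [n] then serves for the operator norms. *)
Lemma coefficients_summable (D : nat -> bounded_op X) :
  (forall x, exists rho l, 0 < rho /\ is_series (dterm (fun k => D k x) (RtoC rho)) l) ->
  exists r, 0 < r /\ ex_series (fun k => rdpow k r * op_norm (D k)).
Proof.
intros H.
(* a single integer [n] bounds both the constant and the rate of growth *)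
destruct (uniform_growth D (fun n k => INR n * INR n ^ k * INR (fact k)))
  as [n [M [HM HDn]]].
{ intros x; destruct (H x) as [rho [l [Hrho Hl]]].
  destruct (dpow_coef_bounded (fun k => D k x) rho l Hrho Hl) as [B HB].
  destruct (nfloor_ex (Rmax (Rmax B (/ rho)) 0) (Rmax_r _ _)) as [n [_ Hn]].
  assert (H1 := Rmax_l (Rmax B (/ rho)) 0).
  assert (H2 := Rmax_l B (/ rho)); assert (H3 := Rmax_r B (/ rho)).
  exists (S n); intros k; rewrite S_INR; set (N := INR n + 1) in *.
  specialize (HB k); unfold rdpow in HB.
  assert (Hf := INR_fact_lt_0 k).
  assert (Hi : 0 < / rho) by now apply Rinv_0_lt_compat.
  assert (Hpk : 0 < rho ^ k) by now apply pow_lt.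
  apply Rle_trans with (B * (/ rho) ^ k * INR (fact k)).
  - rewrite pow_inv; apply Rmult_le_reg_l with (rho ^ k / INR (fact k)).
    { now apply Rdiv_lt_0_compat. }
    replace (rho ^ k / INR (fact k) * (B * / rho ^ k * INR (fact k))) with B
      by (field; lra); exact HB.
  - apply Rmult_le_compat_r; [lra |].
    apply Rle_trans with (N * (/ rho) ^ k).
    + apply Rmult_le_compat_r; [apply pow_le; lra | lra].
    + apply Rmult_le_compat_l; [lra |]; apply pow_incr; lra. }
(* with this radius the terms are dominated by [M n 2^-k] *)
set (r1 := / (2 * (INR n + 1))).
assert (Hn0 := pos_INR n).
assert (Hr1 : 0 < r1) by (apply Rinv_0_lt_compat; lra).
exists r1; split; [exact Hr1 |].
apply ex_series_le_R with (fun k => (M * INR n) * (/ 2) ^ k).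
- intros k; split.
  { apply Rmult_le_pos; [apply rdpow_ge0; lra | apply op_norm_ge0]. }
  apply Rle_trans with (rdpow k r1 * (M * (INR n * INR n ^ k * INR (fact k)))).
  { apply Rmult_le_compat_l; [apply rdpow_ge0; lra | apply HDn]. }
  replace (rdpow k r1 * (M * (INR n * INR n ^ k * INR (fact k))))
    with (M * INR n * (r1 * INR n) ^ k).
  + apply Rmult_le_compat_l; [now apply Rmult_le_pos |].
    apply pow_incr; split; [apply Rmult_le_pos; lra |].
    unfold r1; apply Rmult_le_reg_l with (2 * (INR n + 1)); [lra |].
    rewrite <- Rmult_assoc, Rinv_r by lra; lra.
  + unfold rdpow; rewrite Rpow_mult_distr; field; apply INR_fact_neq_0.
- apply (ex_series_scal (V := R_NormedModule) (M * INR n)).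
  exists (/ (1 - / 2)); apply is_series_geom; rewrite Rabs_pos_eq; lra.
Qed.

(** The expansion holds for each [x] on an interval that depends on [x]; the set of
    [x] for which a given interval works is a closed subspace. *)
Lemma uniform_radius (D : nat -> bounded_op X) (r1 : R) :
  0 < r1 -> ex_series (fun k => rdpow k r1 * op_norm (D k)) ->
  (forall x, exists delta, 0 < delta /\ forall u, Rabs u < delta ->
     is_series (dterm (fun k => D k x) (RtoC u)) (F u x)) ->
  exists r, 0 < r /\ r <= r1 /\ forall u x, Rabs u < r ->
    is_series (dterm (fun k => D k x) (RtoC u)) (F u x).
Proof.
intros Hr1 Hser HDx.
assert (HS : forall u, exists S : bounded_op X, Rabs u < r1 ->
   forall x, is_series (dterm (fun k => D k x) (RtoC u)) (S x)).
{ intros u; destruct (Rlt_dec (Rabs u) r1) as [Hu | Hu].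
  - destruct (op_dseries D (RtoC u) r1) as [S [HS _]]; [rewrite Cmod_R; lra | exact Hser |].
    now exists S.
  - exists (op_zero X); intros; contradiction. }
set (S := fun u => proj1_sig (constructive_indefinite_description _ (HS u))).
assert (HS' : forall u, Rabs u < r1 ->
   forall x, is_series (dterm (fun k => D k x) (RtoC u)) (S u x)).
{ intros u; exact (proj2_sig (constructive_indefinite_description _ (HS u))). }
clearbody S; clear HS.
(* the set for [m] is a closed subspace, the common kernel of the [d u] with
   [|u| < 1/(m+1)]; since it contains a ball, these [d u] vanish *)
set (d := fun u => op_plus (F u) (op_opp (S u))).
destruct (baire (fun m x => forall u, Rabs u < r1 -> Rabs u < / INR (Datatypes.S m) ->
   norm (d u x) <= 0)) as [m [x0 [r [Hr Hball]]]].
- intros m; do 3 (apply rel_closed_forall; intros); apply op_norm_closed.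
- intros x; destruct (HDx x) as [delta [Hdelta Hx]].
  destruct (nfloor_ex (/ delta)) as [m [_ Hm]].
  { now apply Rlt_le, Rinv_0_lt_compat. }
  exists m; intros u Hu Hum.
  assert (Hux : Rabs u < delta).
  { apply Rlt_trans with (1 := Hum); rewrite <- (Rinv_inv delta).
    rewrite S_INR; apply Rinv_lt_contravar; [| exact Hm].
    assert (H := Rinv_0_lt_compat _ Hdelta).
    apply Rmult_lt_0_compat; lra. }
  right.
  assert (E : F u x = S u x).
  { exact (is_series_uniq _ _ _ (Hx u Hux) (HS' u Hu x)). }
  simpl; rewrite E; exact (norm_minus_self (V := X) (S u x)).
- assert (Hm : 0 < / INR (Datatypes.S m)) by (apply Rinv_0_lt_compat, lt_0_INR; lia).
  exists (Rmin r1 (/ INR (Datatypes.S m))); split; [now apply Rmin_glb_lt |]; split.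
  + apply Rmin_l.
  + intros u x Hu.
    assert (H1 : Rabs u < r1) by (apply Rlt_le_trans with (1 := Hu), Rmin_l).
    assert (H2 : Rabs u < / INR (Datatypes.S m)) by (apply Rlt_le_trans with (1 := Hu), Rmin_r).
    assert (H0 : op_norm (d u) <= 4 / r * 0).
    { apply op_norm_le_of_ball with x0; [exact Hr |].
      intros y Hy; now apply Hball. }
    assert (E : F u x = S u x).
    { assert (Hz : d u x = zero).
      { apply norm_eq_zero, Rle_antisym; [| apply norm_ge_0].
        apply Rle_trans with (1 := op_norm_bound (d u) x).
        replace 0 with (4 / r * 0 * norm x) by ring.
        apply Rmult_le_compat_r; [apply norm_ge_0 | exact H0]. }
      etransitivity; [exact (plus_minus_cancel (G := X) (F u x) (S u x)) |].
      etransitivity; [exact (f_equal (fun v : X => plus v (S u x)) Hz) |].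
      exact (plus_zero_l (G := X) (S u x)). }
    rewrite E; now apply HS'.
Qed.

Lemma norm_analytic :
  (forall x, exists (r : posreal) (a : nat -> X), forall u, - r < u < r ->
     is_pseries a (RtoC u) (F u x)) ->
  exists (D : nat -> bounded_op X) (r : R), 0 < r /\
    ex_series (fun k => rdpow k r * op_norm (D k)) /\
    forall u x, Rabs u < r -> is_series (dterm (fun k => D k x) (RtoC u)) (F u x).
Proof.
intros Han.
assert (Han' : forall x, exists p : R * (nat -> X), 0 < fst p /\
   forall u, Rabs u < fst p -> is_series (dterm (snd p) (RtoC u)) (F u x)).
{ intros x; destruct (Han x) as [r [a Ha]].
  exists (r : R, fun k => scal (RtoC (INR (fact k))) (a k)); split; [apply cond_pos |].
  intros u Hu; apply is_pseries_dterm, Ha; simpl in Hu.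
  apply Rabs_def2 in Hu; lra. }
set (p := fun x => proj1_sig (constructive_indefinite_description _ (Han' x))).
assert (Hp : forall x, 0 < fst (p x) /\ forall u, Rabs u < fst (p x) ->
   is_series (dterm (snd (p x)) (RtoC u)) (F u x)).
{ intros x; exact (proj2_sig (constructive_indefinite_description _ (Han' x))). }
clearbody p; clear Han Han'.
destruct (coefficients_bounded (fun x => snd (p x)) (fun x => fst (p x))) as [D HD].
{ intros x; apply Hp. }
{ intros x; apply Hp. }
assert (HDx : forall x u, Rabs u < fst (p x) ->
   is_series (dterm (fun k => D k x) (RtoC u)) (F u x)).
{ intros x u Hu; apply is_series_ext with (2 := proj2 (Hp x) u Hu).
  intros k; unfold dterm; now rewrite HD. }
destruct (coefficients_summable D) as [r1 [Hr1 Hser]].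
{ intros x; assert (H := proj1 (Hp x)).
  exists (fst (p x) / 2), (F (fst (p x) / 2) x); split; [lra |].
  apply HDx; rewrite Rabs_pos_eq; lra. }
destruct (uniform_radius D r1 Hr1 Hser) as [r [Hr [Hrr1 Hexp]]].
{ intros x; exists (fst (p x)); split; [apply Hp | apply HDx]. }
exists D, r; repeat split; [exact Hr | | exact Hexp].
apply ex_series_rdpow_le with r1; [intros; apply op_norm_ge0 | lra | exact Hser].
Qed.
End NormAnalytic.

(** * Holomorphy of operator power series *)

Lemma dterm_at_0 {V : NormedModule C_AbsRing} (b : nat -> V) :
  is_series (dterm b 0%C) (b 0%nat).
Proof.
apply filterlim_ext with (fun _ : nat => b 0%nat); [| apply filterlim_const].
intros n; induction n as [| n IH].
- rewrite sum_O; unfold dterm; rewrite dpow_O.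
  symmetry; exact (scal_one (K := C_Ring) (b 0%nat)).
- rewrite sum_Sn, <- IH; unfold dterm; rewrite dpow_at_0.
  etransitivity; [symmetry; exact (plus_zero_r (b 0%nat)) |].
  f_equal; symmetry; exact (scal_zero_l (K := C_Ring) (b (S n))).
Qed.

Lemma is_derive_quadratic {V : NormedModule C_AbsRing} (f : C -> V) (z : C) (l : V)
    (B e : R) :
  0 < e ->
  (forall eta : C, Cmod eta < e ->
     norm (minus (minus (f (z + eta)%C) (f z)) (scal eta l)) <= B * Cmod eta ^ 2) ->
  is_derive (K := C_AbsRing) f z l.
Proof.
intros He H; split; [apply is_linear_scal_l |].
intros x Hx.
apply (is_filter_lim_locally_unique (V := AbsRing_NormedModule C_AbsRing)) in Hx; subst x.
intros [eps Heps].
assert (HB := Rabs_pos B).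
assert (Hd : 0 < Rmin e (eps / (Rabs B + 1))).
{ apply Rmin_glb_lt; [exact He | apply Rdiv_lt_0_compat; lra]. }
exists (mkposreal _ Hd); intros y Hy.
set (eta := (y - z)%C).
change (Cmod eta < Rmin e (eps / (Rabs B + 1))) in Hy.
assert (Ey : (y : C) = (z + eta)%C).
{ assert (H0 : forall w : C, w = (z + (w - z))%C) by (intros w; ring); exact (H0 y). }
change (norm (minus (minus (f y) (f z)) (scal eta l)) <= eps * Cmod eta).
rewrite Ey.
assert (Hy1 : Cmod eta < e) by (apply Rlt_le_trans with (1 := Hy), Rmin_l).
assert (Hy2 : Cmod eta < eps / (Rabs B + 1)) by (apply Rlt_le_trans with (1 := Hy), Rmin_r).
apply Rle_trans with (1 := H eta Hy1).
assert (H0 := Cmod_ge_0 eta).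
replace (B * Cmod eta ^ 2) with ((B * Cmod eta) * Cmod eta) by ring.
apply Rmult_le_compat_r; [exact H0 |].
apply Rle_trans with ((Rabs B + 1) * Cmod eta).
- apply Rmult_le_compat_r; [exact H0 |]; assert (H1 := Rle_abs B); lra.
- apply (Rmult_lt_compat_l (Rabs B + 1)) in Hy2; [| lra].
  replace ((Rabs B + 1) * (eps / (Rabs B + 1))) with eps in Hy2 by (field; lra); lra.
Qed.

(** The Taylor remainder of order two, uniformly for [x] in the unit ball. *)
Lemma ex_derive_op_series {X : CompleteNormedModule C_AbsRing}
    (G : C -> bounded_op X) (E : nat -> bounded_op X) (z : C) (t e : R) :
  0 < t -> ex_series (fun j => rdpow j t * op_norm (E j)) -> 0 < e ->
  (forall eta, Cmod eta < e -> forall x,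
     is_series (dterm (fun j => E j x) eta) (G (z + eta)%C x)) ->
  ex_derive (K := C_AbsRing) G z.
Proof.
intros Ht [B HB] He HG; exists (E 1%nat).
assert (Hpos : forall j, 0 <= rdpow j t * op_norm (E j)).
{ intros j; apply Rmult_le_pos; [apply rdpow_ge0; lra | apply op_norm_ge0]. }
assert (HBj : forall j, rdpow j t * op_norm (E j) <= B).
{ intros j; apply Rle_trans with (2 := sum_n_le_series _ _ j Hpos HB).
  destruct j as [| j]; [rewrite sum_O; lra |].
  rewrite sum_Sn; assert (H := sum_n_ge0 _ j Hpos); unfold plus; simpl in *; lra. }
assert (HB0 : 0 <= B) by (apply Rle_trans with (1 := Hpos 0%nat), HBj).
apply is_derive_quadratic with (2 * B / t ^ 2) (Rmin e (t / 2)).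
{ apply Rmin_glb_lt; lra. }
intros eta Heta.
assert (Heta1 : Cmod eta < e) by (apply Rlt_le_trans with (1 := Heta), Rmin_l).
assert (Heta2 : Cmod eta < t / 2) by (apply Rlt_le_trans with (1 := Heta), Rmin_r).
assert (H0 := Cmod_ge_0 eta).
apply op_norm_le.
{ apply Rmult_le_pos; [| now apply pow_le].
  apply Rmult_le_pos; [lra | apply Rlt_le, Rinv_0_lt_compat; now apply pow_lt]. }
intros x.
assert (EO : G z x = E 0%nat x).
{ refine (is_series_uniq _ _ _ _ (dterm_at_0 (fun j => E j x))).
  specialize (HG 0%C ltac:(rewrite Cmod_0; lra) x).
  now rewrite Cplus_0_r in HG. }
assert (HT := taylor_remainder (fun j => E j x) (B * norm x) t eta (G (z + eta)%C x) 2 Ht).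
apply Rle_trans with (2 * (B * norm x) * (Cmod eta / t) ^ 2);
  [| right; field; lra].
eapply Rle_trans; [right | apply HT; [| lra | now apply HG]].
- f_equal; simpl; unfold dterm.
  rewrite dpow_O.
  replace (dpow 1 eta) with eta
    by (unfold dpow; simpl; field; exact C1_nz).
  rewrite EO.
  set (a := G (z + eta)%C x); set (b := scal eta (E 1%nat x)).
  transitivity (minus a (plus (E 0%nat x) b)).
  + symmetry; exact (minus_plus_r (G := X) a (E 0%nat x) b).
  + apply (f_equal (minus a)), (f_equal (fun v => plus v b)).
    symmetry; etransitivity; [exact (plus_zero_l (G := X) _) |].
    exact (scal_one (K := C_Ring) (E 0%nat x)).
- intros j; rewrite <- Rmult_assoc in *.
  apply Rle_trans with (rdpow j t * op_norm (E j) * norm x).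
  + rewrite Rmult_assoc; apply Rmult_le_compat_l; [apply rdpow_ge0; lra | apply op_norm_bound].
  + apply Rmult_le_compat_r; [apply norm_ge_0 | apply HBj].
Qed.

(** * Connectedness and sectors in the plane *)

(** The last parameter [m] at which the segment is in [U] is a point of [U] or of
    [V]: in [U] it can only be the end point, in [V] it would be a common point. *)
Lemma segment_stays_in (Omega U V : C -> Prop) (a b : C) :
  open U -> open V -> (forall x, Omega x -> U x \/ V x) ->
  (forall s, 0 <= s <= 1 -> Omega (a + RtoC s * (b - a))%C) ->
  ~ (exists x, Omega x /\ U x /\ V x) -> U a -> U b.
Proof.
intros HU HV Hcov Hseg Hno Ha.
set (g := fun s : R => (a + RtoC s * (b - a))%C).
assert (Hg : forall W : C -> Prop, open W -> forall s, W (g s) ->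
  exists d, 0 < d /\ forall s', Rabs (s' - s) < d -> W (g s')).
{ intros W HW s Hs.
  destruct (HW (g s) Hs) as [[e He] Hball].
  assert (H0 := Cmod_ge_0 (b - a)).
  exists (e / (Cmod (b - a) + 1)); split; [apply Rdiv_lt_0_compat; lra |].
  intros s' Hs'; apply Hball, C_NormedModule_mixin_compat1.
  change (Cmod (g s' - g s) < e).
  replace (g s' - g s)%C with (RtoC (s' - s) * (b - a))%C
    by (unfold g; rewrite RtoC_minus; ring).
  rewrite Cmod_mult, Cmod_R.
  apply Rle_lt_trans with (Rabs (s' - s) * (Cmod (b - a) + 1)).
  - apply Rmult_le_compat_l; [apply Rabs_pos | lra].
  - apply (Rmult_lt_compat_r (Cmod (b - a) + 1)) in Hs'; [| lra].
    replace (e / (Cmod (b - a) + 1) * (Cmod (b - a) + 1)) with e in Hs'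
      by (field; lra); exact Hs'. }
set (S := fun s => 0 <= s <= 1 /\ U (g s)).
assert (H0 : S 0).
{ split; [lra |]; unfold g; replace (a + RtoC 0 * (b - a))%C with a by ring; exact Ha. }
destruct (completeness S) as [m [Hub Hlub]].
{ exists 1; intros s Hs; apply Hs. }
{ now exists 0. }
assert (Hm : 0 <= m <= 1).
{ split; [now apply Hub | apply Hlub; intros s Hs; apply Hs]. }
destruct (Hcov (g m) (Hseg m Hm)) as [HUm | HVm].
- destruct (Hg U HU m HUm) as [d [Hd Hnear]].
  destruct (Req_dec m 1) as [E | E].
  + subst m; unfold g in HUm.
    now replace (a + RtoC 1 * (b - a))%C with b in HUm by ring.
  + exfalso; set (s := Rmin 1 (m + d / 2)).
    assert (H1 := Rmin_l 1 (m + d / 2)); assert (H2 := Rmin_r 1 (m + d / 2)).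
    assert (H3 : m < s) by (apply Rmin_glb_lt; lra).
    fold s in H1, H2.
    assert (HS : S s).
    { split; [lra |]; apply Hnear; rewrite Rabs_pos_eq; lra. }
    specialize (Hub s HS); lra.
- exfalso; destruct (Hg V HV m HVm) as [d [Hd Hnear]].
  assert (Hs : exists s, S s /\ m - d < s).
  { apply NNPP; intros Hn.
    assert (Hb : is_upper_bound S (m - d)).
    { intros s Hs; apply Rnot_lt_le; intros Hlt; apply Hn; now exists s. }
    specialize (Hlub _ Hb); lra. }
  destruct Hs as [s [Hs Hms]].
  apply Hno; exists (g s); split; [apply Hseg, Hs |]; split; [apply Hs |].
  apply Hnear; specialize (Hub s Hs); rewrite Rabs_left1; lra.
Qed.

(** Two points are joined through their projections to the real axis. *)
Lemma connected_of_vertical (Omega : C -> Prop) (t0 : R) :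
  (forall z, Omega z -> t0 < Re z) ->
  (forall s, t0 < s -> Omega (RtoC s)) ->
  (forall z s, Omega z -> 0 <= s <= 1 -> Omega (Re z, s * Im z)) ->
  connected Omega.
Proof.
intros Hre Hreal Hvert U V HU HV Hcov [a [Oa Ua]] [b [Ob Vb]].
apply NNPP; intros Hno.
assert (Hab : U b).
{ apply (segment_stays_in Omega U V (RtoC (Re b)) b); try assumption.
  { intros s Hs.
    replace (RtoC (Re b) + RtoC s * (b - RtoC (Re b)))%C with (Re b, s * Im b).
    - now apply Hvert.
    - unfold Cplus, Cmult, Cminus, Copp, Re, Im; simpl; f_equal; ring. }
  apply (segment_stays_in Omega U V (RtoC (Re a)) (RtoC (Re b))); try assumption.
  { intros s Hs; rewrite <- RtoC_minus, <- RtoC_mult, <- RtoC_plus; apply Hreal.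
    assert (H1 := Hre a Oa); assert (H2 := Hre b Ob).
    replace (Re a + s * (Re b - Re a)) with ((1 - s) * Re a + s * Re b) by ring.
    destruct (Req_dec s 0) as [E | E]; [subst s; lra |].
    assert (H3 : (1 - s) * t0 <= (1 - s) * Re a) by (apply Rmult_le_compat_l; lra).
    assert (H4 : s * t0 < s * Re b) by (apply Rmult_lt_compat_l; lra).
    lra. }
  apply (segment_stays_in Omega U V a (RtoC (Re a))); try assumption.
  intros s Hs.
  replace (a + RtoC s * (RtoC (Re a) - a))%C with (Re a, (1 - s) * Im a).
  - apply Hvert; [exact Oa | lra].
  - unfold Cplus, Cmult, Cminus, Copp, Re, Im; simpl; f_equal; ring. }
apply Hno; now exists b.
Qed.

(** [1 / sqrt (1 + q^2)] is the cosine of the half-angle of the cone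
    [|Im w| < q Re w]. *)
Lemma Carg_lt_cone (w : C) (q : R) :
  0 < q -> 0 < Re w -> Rabs (Carg w) < acos (/ sqrt (1 + q ^ 2)) ->
  Rabs (Im w) < q * Re w.
Proof.
intros Hq Hw H.
assert (Hm : 0 < Cmod w).
{ assert (H0 := re_le_Cmod w); rewrite Rabs_pos_eq in H0; lra. }
set (c := Re w / Cmod w) in *.
assert (Hc : 0 < c) by now apply Rdiv_lt_0_compat.
assert (Hc1 : c <= 1).
{ unfold c; apply Rmult_le_reg_r with (Cmod w); [exact Hm |].
  unfold Rdiv; rewrite Rmult_assoc, Rinv_l by lra.
  assert (H0 := re_le_Cmod w); rewrite Rabs_pos_eq in H0; lra. }
assert (Ha : acos c < acos (/ sqrt (1 + q ^ 2))).
{ replace (acos c) with (Rabs (Carg w)); [exact H |].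
  assert (Hb := acos_bound c).
  unfold Carg; fold c; destruct (Rlt_dec (Im w) 0).
  - rewrite Rabs_Ropp, Rabs_pos_eq; lra.
  - rewrite Rabs_pos_eq; lra. }
assert (Hq2 : 0 < q ^ 2) by now apply pow_lt.
assert (Hs : 1 < sqrt (1 + q ^ 2)).
{ apply Rle_lt_trans with (sqrt 1); [rewrite sqrt_1; lra | apply sqrt_lt_1; lra]. }
assert (Hsi : 0 < / sqrt (1 + q ^ 2) < 1).
{ split; [apply Rinv_0_lt_compat; lra |].
  apply Rmult_lt_reg_l with (sqrt (1 + q ^ 2)); [lra |].
  rewrite Rinv_r; lra. }
assert (Hlt : / sqrt (1 + q ^ 2) < c).
{ rewrite <- (cos_acos (/ sqrt (1 + q ^ 2))) by lra.
  rewrite <- (cos_acos c) by lra.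
  apply cos_decreasing_1; try apply acos_bound; exact Ha. }
assert (Hmod : Cmod w < sqrt (1 + q ^ 2) * Re w).
{ apply (Rmult_lt_compat_r (Cmod w * sqrt (1 + q ^ 2))) in Hlt.
  - unfold c in Hlt.
    replace (/ sqrt (1 + q ^ 2) * (Cmod w * sqrt (1 + q ^ 2))) with (Cmod w) in Hlt
      by (field; lra).
    replace (Re w / Cmod w * (Cmod w * sqrt (1 + q ^ 2)))
      with (sqrt (1 + q ^ 2) * Re w) in Hlt by (field; lra).
    exact Hlt.
  - apply Rmult_lt_0_compat; lra. }
assert (Hsq : Cmod w ^ 2 < (1 + q ^ 2) * Re w ^ 2).
{ replace ((1 + q ^ 2) * Re w ^ 2) with ((sqrt (1 + q ^ 2) * Re w) ^ 2).
  - rewrite <- (Rsqr_pow2 (Cmod w)), <- (Rsqr_pow2 (sqrt (1 + q ^ 2) * Re w)).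
    apply Rsqr_incrst_1; lra.
  - rewrite Rpow_mult_distr, pow2_sqrt; lra. }
rewrite Cmod2_alt in Hsq.
apply Rsqr_incrst_0.
- unfold Rsqr; rewrite <- Rabs_mult, Rabs_pos_eq by apply Rle_0_sqr.
  nra.
- apply Rabs_pos.
- apply Rmult_le_pos; lra.
Qed.

(** * Taylor coefficients of a semigroup *)

Section Semigroup.
Context {X : CompleteNormedModule C_AbsRing}.
Variables (T : R -> bounded_op X) (t0 : R).
Hypothesis HT : semigroup_property T.
Hypothesis ht0 : 0 < t0.
Variable D : nat -> R -> bounded_op X.

Definition abs_conv (c rho : R) : Prop :=
  ex_series (fun k => rdpow k rho * op_norm (D k c)).

(** [D k s] is in effect the [k]-th derivative of [T] at [s]; the radius is common to
    all [x]. *)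
Definition taylor_family : Prop := forall s, t0 < s -> exists r, 0 < r /\ abs_conv s r /\
  forall u x, Rabs u < r -> is_series (dterm (fun k => D k s x) (RtoC u)) (T (s + u) x).

Hypothesis HD : taylor_family.

Lemma abs_conv_orbit (c rho : R) (x : X) :
  0 <= rho -> abs_conv c rho -> ex_series (fun k => rdpow k rho * norm (D k c x)).
Proof.
intros Hrho H.
apply ex_series_le_R with (fun k => rdpow k rho * op_norm (D k c) * norm x).
- intros k; assert (Hk := rdpow_ge0 k rho Hrho); split.
  + apply Rmult_le_pos; [exact Hk | apply norm_ge_0].
  + rewrite Rmult_assoc; apply Rmult_le_compat_l; [exact Hk | apply op_norm_bound].
- exact (ex_series_scal_r (norm x) _ H).
Qed.

Lemma coef_O (s : R) (x : X) : t0 < s -> D 0 s x = T s x.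
Proof.
intros Hs; destruct (HD s Hs) as [r [Hr [_ Hser]]].
specialize (Hser 0 x); rewrite Rabs_R0, Rplus_0_r in Hser.
exact (is_series_uniq _ _ _ (dterm_at_0 (fun k => D k s x)) (Hser Hr)).
Qed.

(** Re-expanding the Taylor series at [c] gives an expansion of [T] at [c + u],
    whose coefficients must be the [D_j(c + u)].  The interval depends on [c] only,
    not on [j] or [x]. *)
Lemma coef_reexpand (c : R) : t0 < c ->
  exists delta, 0 < delta /\ forall u, Rabs u < delta -> t0 < c + u /\
    forall j x, is_series (dterm (fun k => D (j + k)%nat c x) (RtoC u)) (D j (c + u) x).
Proof.
intros Hc; destruct (HD c Hc) as [r [Hr [Habs Hser]]].
exists (Rmin (r / 4) (c - t0)); split; [apply Rmin_glb_lt; lra |].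
intros u Hu.
assert (Hu1 : Rabs u < r / 4) by (apply Rlt_le_trans with (1 := Hu), Rmin_l).
assert (Hu2 : Rabs u < c - t0) by (apply Rlt_le_trans with (1 := Hu), Rmin_r).
assert (Hcu : t0 < c + u) by (apply Rabs_def2 in Hu2; lra).
split; [exact Hcu |].
assert (Habs' : abs_conv c (r / 4 + r / 4)).
{ apply ex_series_rdpow_le with r; [intros; apply op_norm_ge0 | lra | exact Habs]. }
destruct (rdpow_reexpand (fun k => op_norm (D k c)) (r / 4) (r / 4)) as [Hrow _];
  [intros; apply op_norm_ge0 | lra | lra | exact Habs' |].
assert (HS : forall j, exists S : bounded_op X, forall x,
   is_series (dterm (fun k => D (j + k)%nat c x) (RtoC u)) (S x)).
{ intros j; destruct (op_dseries (fun k => D (j + k)%nat c) (RtoC u) (r / 4))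
    as [S [HS _]]; [rewrite Cmod_R; lra | apply Hrow | now exists S]. }
intros j x.
destruct (HD (c + u) Hcu) as [r' [Hr' [_ Hser']]].
set (S := fun j => proj1_sig (constructive_indefinite_description _ (HS j))).
assert (HS' : forall j x, is_series (dterm (fun k => D (j + k)%nat c x) (RtoC u)) (S j x)).
{ intros i; exact (proj2_sig (constructive_indefinite_description _ (HS i))). }
clearbody S; clear HS.
replace (D j (c + u) x) with (S j x); [apply HS' |].
revert j; apply (dpow_coef_unique (fun j => S j x) (fun j => D j (c + u) x)
  (fun v => T (c + u + v) x) (Rmin r' (r / 4))).
- apply Rmin_glb_lt; lra.
- intros v Hv.
  assert (Hv' : Rabs v < r / 4) by (apply Rlt_le_trans with (1 := Hv), Rmin_r).
  apply (dpow_reexpand (fun k => D k c x) (fun j => S j x) (RtoC u) (RtoC v) (r / 4) (r / 4)).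
  + rewrite Cmod_R; lra.
  + rewrite Cmod_R; lra.
  + apply abs_conv_orbit; [lra | exact Habs'].
  + intros j; apply HS'.
  + rewrite <- RtoC_plus, Rplus_assoc; apply Hser.
    apply Rle_lt_trans with (1 := Rabs_triang u v); lra.
- intros v Hv; apply Hser'; apply Rlt_le_trans with (1 := Hv), Rmin_l.
Qed.

(** Both sides are the Taylor coefficients of [u => T(s + u) T(h) x]. *)
Lemma coef_shift_r (s h : R) (j : nat) (x : X) :
  t0 < s -> 0 <= h -> D j (s + h) x = D j s (T h x).
Proof.
intros Hs Hh.
destruct (HD s Hs) as [r [Hr [_ Hser]]].
destruct (HD (s + h) ltac:(lra)) as [r' [Hr' [_ Hser']]].
revert j; apply (dpow_coef_unique (fun j => D j (s + h) x) (fun j => D j s (T h x))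
  (fun u => T (s + h + u) x) (Rmin r' (Rmin r s))).
- repeat apply Rmin_glb_lt; lra.
- intros u Hu; apply Hser', Rlt_le_trans with (1 := Hu), Rmin_l.
- intros u Hu.
  assert (Hu1 : Rabs u < Rmin r s) by (apply Rlt_le_trans with (1 := Hu), Rmin_r).
  assert (Hu2 : Rabs u < r) by (apply Rlt_le_trans with (1 := Hu1), Rmin_l).
  assert (Hu3 : Rabs u < s) by (apply Rlt_le_trans with (1 := Hu1), Rmin_r).
  apply Rabs_def2 in Hu3.
  replace (s + h + u) with (s + u + h) by ring.
  rewrite HT by lra; apply Hser, Hu2.
Qed.

Lemma coef_shift_l (s h : R) (j : nat) (x : X) :
  t0 < s -> 0 <= h -> D j (h + s) x = T h (D j s x).
Proof.
intros Hs Hh.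
destruct (HD s Hs) as [r [Hr [_ Hser]]].
destruct (HD (h + s) ltac:(lra)) as [r' [Hr' [_ Hser']]].
revert j; apply (dpow_coef_unique (fun j => D j (h + s) x) (fun j => T h (D j s x))
  (fun u => T (h + s + u) x) (Rmin r' (Rmin r s))).
- repeat apply Rmin_glb_lt; lra.
- intros u Hu; apply Hser', Rlt_le_trans with (1 := Hu), Rmin_l.
- intros u Hu.
  assert (Hu1 : Rabs u < Rmin r s) by (apply Rlt_le_trans with (1 := Hu), Rmin_r).
  assert (Hu2 : Rabs u < r) by (apply Rlt_le_trans with (1 := Hu1), Rmin_l).
  assert (Hu3 : Rabs u < s) by (apply Rlt_le_trans with (1 := Hu1), Rmin_r).
  apply Rabs_def2 in Hu3.
  rewrite Rplus_assoc, HT by lra.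
  exact (op_dterm (T h) (fun k => D k s x) (RtoC u) _ (Hser u x Hu2)).
Qed.

(** For fixed [j], both sides are the coefficients of [v => D_j(c + d + v) x]: on the
    left by [coef_reexpand], on the right because
    [D_j(c + (d + v)) = D_j(c) T(d + v)]. *)
Lemma coef_add (c d : R) (j k : nat) (x : X) :
  t0 < c -> t0 < d -> D (j + k) (c + d) x = D j c (D k d x).
Proof.
intros Hc Hd.
destruct (coef_reexpand (c + d) ltac:(lra)) as [r [Hr Hre]].
destruct (HD d Hd) as [r' [Hr' [_ Hser]]].
revert k; apply (dpow_coef_unique (fun k => D (j + k)%nat (c + d) x)
  (fun k => D j c (D k d x)) (fun v => D j (c + d + v) x) (Rmin r (Rmin r' d))).
- repeat apply Rmin_glb_lt; lra.
- intros v Hv; apply Hre, Rlt_le_trans with (1 := Hv), Rmin_l.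
- intros v Hv.
  assert (Hv1 : Rabs v < Rmin r' d) by (apply Rlt_le_trans with (1 := Hv), Rmin_r).
  assert (Hv2 : Rabs v < r') by (apply Rlt_le_trans with (1 := Hv1), Rmin_l).
  assert (Hv3 : Rabs v < d) by (apply Rlt_le_trans with (1 := Hv1), Rmin_r).
  apply Rabs_def2 in Hv3.
  rewrite Rplus_assoc, coef_shift_r by lra.
  exact (op_dterm (D j c) (fun k => D k d x) (RtoC v) _ (Hser v x Hv2)).
Qed.

Lemma abs_conv_shift (c h rho : R) :
  t0 < c -> 0 <= h -> 0 <= rho -> abs_conv c rho -> abs_conv (h + c) rho.
Proof.
intros Hc Hh Hrho H.
apply ex_series_le_R with (fun k => rdpow k rho * op_norm (D k c) * op_norm (T h)).
- intros k; assert (Hk := rdpow_ge0 k rho Hrho); split.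
  + apply Rmult_le_pos; [exact Hk | apply op_norm_ge0].
  + rewrite Rmult_assoc; apply Rmult_le_compat_l; [exact Hk |].
    rewrite Rmult_comm; apply Rle_trans with (2 := op_norm_comp (T h) (D k c)).
    right; f_equal; apply bounded_op_ext; intros x; now apply coef_shift_l.
- exact (ex_series_scal_r (op_norm (T h)) _ H).
Qed.

(** By [coef_add] and the binomial formula, the terms are dominated by those of the
    Cauchy product of the two given series. *)
Lemma abs_conv_add (c d rho rho' : R) :
  t0 < c -> t0 < d -> 0 <= rho -> 0 <= rho' ->
  abs_conv c rho -> abs_conv d rho' -> abs_conv (c + d) (rho + rho').
Proof.
intros Hc Hd Hrho Hrho' [l Hl] [l' Hl'].
assert (Hp := is_series_mult_pos _ _ _ _ Hl Hl').
apply ex_series_le_R with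
  (2 := ex_intro _ _ (Hp (fun k => Rmult_le_pos _ _ (rdpow_ge0 k rho Hrho) (op_norm_ge0 _))
                         (fun k => Rmult_le_pos _ _ (rdpow_ge0 k rho' Hrho') (op_norm_ge0 _)))).
intros m; split.
{ apply Rmult_le_pos; [apply rdpow_ge0; lra | apply op_norm_ge0]. }
rewrite (Rplus_comm rho), <- rdpow_binomial, <- sum_n_Reals.
rewrite <- (sum_n_mult_r (K := R_Ring)).
apply sum_n_le_loc; intros j Hj.
assert (H1 : op_norm (D m (c + d)) <= op_norm (D j c) * op_norm (D (m - j)%nat d)).
{ apply Rle_trans with (2 := op_norm_comp _ _); right; f_equal.
  apply bounded_op_ext; intros x.
  replace m with (j + (m - j))%nat at 1 by lia; now apply coef_add. }
assert (H2 := rdpow_ge0 j rho Hrho); assert (H3 := rdpow_ge0 (m - j) rho' Hrho').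
apply (Rmult_le_compat_l (rdpow j rho * rdpow (m - j) rho')) in H1;
  [| now apply Rmult_le_pos].
unfold mult; simpl; lra.
Qed.

Lemma abs_conv_multiple (c rho : R) (n : nat) :
  t0 < c -> 0 <= rho -> abs_conv c rho ->
  abs_conv (INR (S n) * c) (INR (S n) * rho).
Proof.
intros Hc Hrho H; induction n as [| n IH].
- now rewrite !Rmult_1_l.
- rewrite S_INR, !Rmult_plus_distr_r, !Rmult_1_l.
  assert (Hn : 1 <= INR (S n)) by (rewrite S_INR; assert (Hn := pos_INR n); lra).
  apply abs_conv_add; try assumption.
  + apply Rlt_le_trans with (1 * c); [lra | apply Rmult_le_compat_r; lra].
  + apply Rmult_le_pos; lra.
Qed.

(** * The region of extension *)

(** Asking for convergence at some [c < Re z], and not at [Re z] itself, makes the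
    region visibly open. *)
Definition region (z : C) : Prop :=
  exists c rho, t0 < c < Re z /\ Rabs (Im z) < rho /\ abs_conv c rho.

Definition i_Im (z : C) : C := (0, Im z).

Lemma Cmod_i_Im (z : C) : Cmod (i_Im z) = Rabs (Im z).
Proof.
unfold Cmod, i_Im; simpl; rewrite <- sqrt_Rsqr_abs; f_equal; unfold Rsqr; ring.
Qed.

Lemma region_abs_conv (z : C) :
  region z -> t0 < Re z /\ exists rho, Rabs (Im z) < rho /\ abs_conv (Re z) rho.
Proof.
intros [c [rho [Hc [Hz H]]]]; split; [lra |].
exists rho; split; [exact Hz |].
replace (Re z) with (Re z - c + c) by ring.
apply abs_conv_shift; try lra; [| exact H].
assert (H0 := Rabs_pos (Im z)); lra.
Qed.

Lemma region_translate (h : R) (z : C) : 0 <= h -> region z -> region (RtoC h + z)%C.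
Proof.
intros Hh [c [rho [Hc [Hz H]]]]; exists c, rho; simpl; rewrite Rplus_0_l.
repeat split; try assumption; try apply Hc; unfold Re in Hc; lra.
Qed.

Lemma region_add (z w : C) : region z -> region w -> region (z + w)%C.
Proof.
intros [c [rho [Hc [Hz H]]]] [d [rho' [Hd [Hw H']]]].
assert (Hz0 := Rabs_pos (Im z)); assert (Hw0 := Rabs_pos (Im w)).
exists (c + d), (rho + rho'); simpl; unfold Re, Im in *; repeat split; try lra.
- apply Rle_lt_trans with (1 := Rabs_triang _ _); lra.
- apply abs_conv_add; lra || assumption.
Qed.

Lemma region_open (z : C) : region z ->
  exists e, 0 < e /\ forall w, Rabs (Re w - Re z) < e -> Rabs (Im w - Im z) < e -> region w.
Proof.
intros [c [rho [Hc [Hz H]]]].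
exists (Rmin (Re z - c) (rho - Rabs (Im z))); split; [apply Rmin_glb_lt; lra |].
intros w Hr Hi; exists c, rho.
assert (H1 := Rmin_l (Re z - c) (rho - Rabs (Im z))).
assert (H2 := Rmin_r (Re z - c) (rho - Rabs (Im z))).
assert (H3 := Rabs_triang (Im w - Im z) (Im z)).
replace (Im w - Im z + Im z) with (Im w) in H3 by ring.
apply Rabs_def2 in Hr.
repeat split; try assumption; lra.
Qed.

Lemma region_Re_gt (z : C) : region z -> t0 < Re z.
Proof. intros [c [rho [Hc _]]]; lra. Qed.

Lemma region_real (s : R) : t0 < s -> region (RtoC s).
Proof.
intros Hs; destruct (HD ((t0 + s) / 2)) as [r [Hr [Habs _]]]; [lra |].
exists ((t0 + s) / 2), r; simpl; rewrite Rabs_R0; repeat split; lra || assumption.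
Qed.

Lemma region_domain : is_domain region.
Proof.
split.
- intros z Hz; destruct (region_open z Hz) as [e [He Hball]].
  exists (mkposreal e He); intros w [H1 H2]; now apply Hball.
- apply connected_of_vertical with t0; [exact region_Re_gt | exact region_real |].
  intros z s [c [rho [Hc [Hz H]]]] Hs; exists c, rho; repeat split; try apply Hc; [| exact H].
  simpl; rewrite Rabs_mult, (Rabs_pos_eq s) by lra.
  apply Rle_lt_trans with (2 := Hz).
  rewrite <- (Rmult_1_l (Rabs (Im z))) at 2.
  apply Rmult_le_compat_r; [apply Rabs_pos | lra].
Qed.

(** With [t0 < c < t] and radius [r] at [c], the slope of the cone is [r / t]:
    for [n t <= Re z < (n + 1) t] it confines [|Im z|] below [n r], the radius at
    [n c]. *)
Lemma region_sector (t : R) : t0 < t ->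
  exists theta, 0 < theta <= PI / 2 /\ forall z, sector t theta z -> region z.
Proof.
intros Ht.
set (c := (t0 + t) / 2).
destruct (HD c) as [r [Hr [Habs _]]]; [unfold c; lra |].
set (q := r / t).
assert (Hq : 0 < q) by (apply Rdiv_lt_0_compat; lra).
exists (acos (/ sqrt (1 + q ^ 2))).
assert (Hq2 : 0 < q ^ 2) by now apply pow_lt.
assert (Hs : 1 < sqrt (1 + q ^ 2)).
{ apply Rle_lt_trans with (sqrt 1); [rewrite sqrt_1; lra | apply sqrt_lt_1; lra]. }
assert (Hsi : 0 < / sqrt (1 + q ^ 2) < 1).
{ split; [apply Rinv_0_lt_compat; lra |].
  apply Rmult_lt_reg_l with (sqrt (1 + q ^ 2)); [lra |].
  rewrite Rinv_r; lra. }
split.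
- split; [apply acos_bound_lt; lra |].
  rewrite acos_atan by lra.
  apply Rlt_le, atan_bound.
- intros z [Hz Hcarg].
  apply Carg_lt_cone in Hcarg; [| exact Hq | unfold Re in *; simpl; lra].
  replace (Im (z - RtoC t)) with (Im z) in Hcarg by (unfold Im; simpl; ring).
  replace (Re (z - RtoC t)) with (Re z - t) in Hcarg by (unfold Re; simpl; ring).
  destruct (nfloor_ex (Re z / t)) as [n [Hn1 Hn2]].
  { apply Rlt_le, Rdiv_lt_0_compat; lra. }
  apply (Rmult_le_compat_r t) in Hn1; [| lra].
  apply (Rmult_lt_compat_r t) in Hn2; [| lra].
  replace (Re z / t * t) with (Re z) in Hn1, Hn2 by (field; lra).
  destruct n as [| n]; [simpl in Hn2; lra |].
  assert (Hn := pos_INR n).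
  exists (INR (S n) * c), (INR (S n) * r); rewrite S_INR in *.
  repeat split.
  * apply Rlt_le_trans with (1 * c); [unfold c; lra |].
    apply Rmult_le_compat_r; [unfold c; lra | lra].
  * apply Rlt_le_trans with (2 := Hn1).
    apply Rmult_lt_compat_l; [lra | unfold c; lra].
  * apply Rlt_le_trans with (1 := Hcarg).
    apply Rle_trans with (q * ((INR n + 1) * t)).
    { apply Rmult_le_compat_l; lra. }
    right; unfold q; field; lra.
  * rewrite <- S_INR.
    apply abs_conv_multiple; [unfold c; lra | lra | exact Habs].
Qed.

(** * The holomorphic extension *)

(** The two requirements agree on the real axis by [coef_O]. *)
Lemma extension_exists : exists Text : C -> bounded_op X,
  (forall s, Text (RtoC s) = T s) /\
  (forall z, region z -> forall x,
     is_series (dterm (fun k => D k (Re z) x) (i_Im z)) (Text z x)).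
Proof.
enough (H : forall z, exists A : bounded_op X, (Im z = 0 -> A = T (Re z)) /\
  (region z -> forall x, is_series (dterm (fun k => D k (Re z) x) (i_Im z)) (A x))).
{ exists (fun z => proj1_sig (constructive_indefinite_description _ (H z))); split.
  - intros s; exact (proj1 (proj2_sig (constructive_indefinite_description _ (H (RtoC s))))
      eq_refl).
  - intros z; exact (proj2 (proj2_sig (constructive_indefinite_description _ (H z)))). }
intros z; destruct (Req_dec (Im z) 0) as [Hz | Hz].
- exists (T (Re z)); split; [easy |]; intros HO x.
  destruct (region_abs_conv z HO) as [Hc _].
  unfold i_Im; rewrite Hz, <- coef_O by exact Hc.
  exact (dterm_at_0 (fun k => D k (Re z) x)).
- destruct (classic (region z)) as [HO | HO].
  + destruct (region_abs_conv z HO) as [Hc [rho [Hrho H]]].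
    destruct (op_dseries (fun k => D k (Re z)) (i_Im z) rho) as [S [HS _]];
      [rewrite Cmod_i_Im; lra | exact H |].
    exists S; split; [contradiction | intros _; exact HS].
  + exists (op_zero X); split; [contradiction | contradiction].
Qed.

Variable Text : C -> bounded_op X.
Hypothesis HText : forall z, region z -> forall x,
  is_series (dterm (fun k => D k (Re z) x) (i_Im z)) (Text z x).

(** Re-expansion of the series of [z + w] in powers of [i Im z]; by [coef_add] its
    [j]-th row is [D_j(Re z) T(w) x]. *)
Lemma extension_semigroup (z w : C) :
  region z -> region w -> Text (z + w)%C = op_comp (Text z) (Text w).
Proof.
intros Hz Hw; apply bounded_op_ext; intros x.
destruct (region_abs_conv z Hz) as [Hc [rho [Hrho H]]].
destruct (region_abs_conv w Hw) as [Hd [rho' [Hrho' H']]].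
assert (Hz0 := Rabs_pos (Im z)); assert (Hw0 := Rabs_pos (Im w)).
refine (is_series_uniq _ _ _ _ (HText z Hz (Text w x))).
apply (dpow_reexpand (fun m => D m (Re z + Re w) x)
         (fun j => D j (Re z) (Text w x)) (i_Im w) (i_Im z) rho' rho).
- rewrite Cmod_i_Im; lra.
- rewrite Cmod_i_Im; lra.
- apply abs_conv_orbit; [lra |].
  rewrite (Rplus_comm rho'); apply abs_conv_add; lra || assumption.
- intros j.
  assert (Hj := op_dterm (D j (Re z)) _ _ _ (HText w Hw x)).
  revert Hj; apply is_series_ext; intros k; unfold dterm; now rewrite coef_add.
- replace (i_Im w + i_Im z)%C with (i_Im (z + w)%C).
  + exact (HText _ (region_add z w Hz Hw) x).
  + unfold i_Im, Cplus, Im; simpl; f_equal; ring.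
Qed.

Lemma extension_translate_l (h : R) (z : C) :
  0 <= h -> region z -> Text (RtoC h + z)%C = op_comp (T h) (Text z).
Proof.
intros Hh Hz; apply bounded_op_ext; intros x.
refine (is_series_uniq _ _ _ (HText _ (region_translate h z Hh Hz) x) _).
destruct (region_abs_conv z Hz) as [Hc _].
replace (i_Im (RtoC h + z)%C) with (i_Im z) by (unfold i_Im; simpl; now rewrite Rplus_0_l).
assert (H := op_dterm (T h) _ _ _ (HText z Hz x)).
revert H; apply is_series_ext; intros k; unfold dterm.
f_equal; symmetry; exact (coef_shift_l (Re z) h k x Hc Hh).
Qed.

Lemma extension_translate_r (h : R) (z : C) :
  0 <= h -> region z -> Text (z + RtoC h)%C = op_comp (Text z) (T h).
Proof.
intros Hh Hz; rewrite Cplus_comm; apply bounded_op_ext; intros x.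
refine (is_series_uniq _ _ _ (HText _ (region_translate h z Hh Hz) x) _).
destruct (region_abs_conv z Hz) as [Hc _].
replace (i_Im (RtoC h + z)%C) with (i_Im z) by (unfold i_Im; simpl; now rewrite Rplus_0_l).
assert (H := HText z Hz (T h x)).
revert H; apply is_series_ext; intros k; unfold dterm.
f_equal; symmetry; rewrite <- (coef_shift_r (Re z) h k x Hc Hh); simpl.
unfold Re; now rewrite Rplus_comm.
Qed.

(** Near [z] the values of the extension are those of one power series [L] centred
    at the real point [Re z], by re-expansion in the real direction.  Its
    re-expansion at [i Im z] has the coefficients [E]. *)
Lemma extension_taylor (z : C) : region z ->
  exists (E : nat -> bounded_op X) (t : R), 0 < t /\
    ex_series (fun j => rdpow j t * op_norm (E j)) /\
    exists e, 0 < e /\ forall eta, Cmod eta < e -> forall x,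
      is_series (dterm (fun j => E j x) eta) (Text (z + eta)%C x).
Proof.
intros Hz.
destruct (region_abs_conv z Hz) as [Hc [rho [Hrho H]]].
destruct (region_open z Hz) as [e1 [He1 Hopen]].
destruct (coef_reexpand (Re z) Hc) as [delta [Hdelta Hre]].
set (s := Rabs (Im z)) in *; set (t := rho - s).
assert (Hs : 0 <= s) by apply Rabs_pos.
assert (Ht : 0 < t) by (unfold t; lra).
assert (Hst : abs_conv (Re z) (s + t)) by (unfold t; now replace (s + (rho - s)) with rho by ring).
destruct (rdpow_reexpand (fun k => op_norm (D k (Re z))) s t) as [Hrow Hcol];
  [intros; apply op_norm_ge0 | exact Hs | exact Ht | exact Hst |].
assert (HE : forall j, exists S : bounded_op X,
  (forall x, is_series (dterm (fun k => D (j + k)%nat (Re z) x) (i_Im z)) (S x)) /\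
  op_norm S <= Series (fun k => rdpow k s * op_norm (D (j + k)%nat (Re z)))).
{ intros j; apply op_dseries; [rewrite Cmod_i_Im; apply Rle_refl | apply Hrow]. }
set (E := fun j => proj1_sig (constructive_indefinite_description _ (HE j))).
assert (HE' : forall j,
  (forall x, is_series (dterm (fun k => D (j + k)%nat (Re z) x) (i_Im z)) (E j x)) /\
  op_norm (E j) <= Series (fun k => rdpow k s * op_norm (D (j + k)%nat (Re z)))).
{ intros j; exact (proj2_sig (constructive_indefinite_description _ (HE j))). }
clearbody E; clear HE.
exists E, t; split; [exact Ht |]; split.
{ apply ex_series_le_R with (2 := Hcol); intros j.
  assert (Hj := rdpow_ge0 j t (Rlt_le _ _ Ht)); split.
  - apply Rmult_le_pos; [exact Hj | apply op_norm_ge0].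
  - apply Rmult_le_compat_l; [exact Hj | apply HE']. }
exists (Rmin (t / 2) (Rmin e1 delta)); split; [repeat apply Rmin_glb_lt; lra |].
intros eta Heta x.
assert (Heta1 : Cmod eta < t / 2) by (apply Rlt_le_trans with (1 := Heta), Rmin_l).
assert (Heta2 : Cmod eta < Rmin e1 delta) by (apply Rlt_le_trans with (1 := Heta), Rmin_r).
assert (Heta3 : Cmod eta < e1) by (apply Rlt_le_trans with (1 := Heta2), Rmin_l).
assert (Heta4 : Cmod eta < delta) by (apply Rlt_le_trans with (1 := Heta2), Rmin_r).
assert (Hre1 : Rabs (Re eta) <= Cmod eta) by apply re_le_Cmod.
assert (Him1 : Rabs (Im eta) <= Cmod eta)
  by (apply Rle_trans with (2 := Rmax_Cmod eta), Rmax_r).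
assert (HO : region (z + eta)%C).
{ apply Hopen; simpl; unfold Re, Im in *;
    [replace (fst z + fst eta - fst z) with (fst eta) by ring
    |replace (snd z + snd eta - snd z) with (snd eta) by ring]; lra. }
(* the same point seen from [Re z]: horizontally then vertically, or through [z] *)
assert (Hsum : (RtoC (Re eta) + i_Im (z + eta) = i_Im z + eta)%C).
{ unfold i_Im, Cplus, Re, Im; simpl; f_equal; ring. }
(* [L] sums the power series centred at [Re z] *)
destruct (op_dseries (fun k => D k (Re z)) (i_Im z + eta)%C (s + t)) as [L [HL _]].
{ apply Rle_trans with (1 := Cmod_triangle _ _); rewrite Cmod_i_Im; fold s; lra. }
{ exact Hst. }
assert (HLx : Text (z + eta)%C x = L x).
{ refine (is_series_uniq _ _ _ (HText _ HO x) _).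
  apply (dpow_reexpand (fun k => D k (Re z) x) _ (RtoC (Re eta)) (i_Im (z + eta)%C)
           (t / 2) (s + t / 2)).
  - rewrite Cmod_R; lra.
  - rewrite Cmod_i_Im; simpl; unfold Im in *.
    apply Rle_trans with (1 := Rabs_triang _ _); fold s; unfold s; lra.
  - apply abs_conv_orbit; [lra |].
    now replace (t / 2 + (s + t / 2)) with (s + t) by field.
  - intros j; apply (Hre (Re eta) ltac:(lra)).
  - rewrite Hsum; apply HL. }
rewrite HLx.
apply (dpow_reexpand (fun k => D k (Re z) x) (fun j => E j x) (i_Im z) eta s t).
- rewrite Cmod_i_Im; apply Rle_refl.
- lra.
- apply abs_conv_orbit; [lra | exact Hst].
- intros j; apply HE'.
- apply HL.
Qed.

Lemma extension_holomorphic : holomorphic_on Text region.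
Proof.
intros z Hz.
destruct (extension_taylor z Hz) as [E [r [Hr [HE [e [He Hser]]]]]].
exact (ex_derive_op_series Text E z r e Hr HE He Hser).
Qed.

End Semigroup.

(** Moving the base point to [0] turns the hypothesis on orbits into [norm_analytic] for
    [u => T(s + u)]; the choice of [D] over all [s] is arbitrary for [s <= t0]. *)
Lemma taylor_family_exists (X : CompleteNormedModule C_AbsRing)
    (T : R -> bounded_op X) (t0 : R) :
  (forall x : X, real_analytic_on (fun s => T s x) (fun s => t0 < s)) ->
  exists D, taylor_family T t0 D.
Proof.
intros Han.
assert (Hloc : forall s, exists p : (nat -> bounded_op X) * R, t0 < s ->
  0 < snd p /\ ex_series (fun k => rdpow k (snd p) * op_norm (fst p k)) /\
  forall u x, Rabs u < snd p ->
    is_series (dterm (fun k => fst p k x) (RtoC u)) (T (s + u) x)).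
{ intros s; destruct (Rlt_dec t0 s) as [Hs | Hs].
  - destruct (norm_analytic (fun u => T (s + u))) as [D [r Hr]].
    + intros x; destruct (Han x s Hs) as [r [a Ha]]; exists r, a; intros u Hu.
      replace (RtoC u) with (RtoC (s + u - s)) by (f_equal; ring).
      apply Ha; lra.
    + exists (D, r); now intros _.
  - exists (fun _ => op_zero X, 0); intros; contradiction. }
set (p := fun s => proj1_sig (constructive_indefinite_description _ (Hloc s))).
assert (Hp : forall s, t0 < s ->
  0 < snd (p s) /\ ex_series (fun k => rdpow k (snd (p s)) * op_norm (fst (p s) k)) /\
  forall u x, Rabs u < snd (p s) ->
    is_series (dterm (fun k => fst (p s) k x) (RtoC u)) (T (s + u) x)).
{ intros s; exact (proj2_sig (constructive_indefinite_description _ (Hloc s))). }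
exists (fun k s => fst (p s) k); intros s Hs; exists (snd (p s)); exact (Hp s Hs).
Qed.

Theorem proposition3p29 (X : CompleteNormedModule C_AbsRing)
    (T : R -> bounded_op X) (t0 : R)
    (HT : semigroup_property T)
    (ht0 : 0 < t0)
    (Han : forall x : X, real_analytic_on (fun s => T s x) (fun s => t0 < s)) :
  forall t : R, t0 < t ->
    exists Omega : C -> Prop,
      is_domain Omega /\
      ((forall s : R, t <= s -> Omega (RtoC s)) /\
       (forall (h : R) (z : C), 0 <= h -> Omega z -> Omega (Cplus (RtoC h) z))) /\
      (forall z w : C, Omega z -> Omega w -> Omega (Cplus z w)) /\
      (exists theta : R, 0 < theta <= PI / 2 /\
         forall z : C, sector t theta z -> Omega z) /\
      (exists Text : C -> bounded_op X,
         (forall s : R, 0 <= s -> Text (RtoC s) = T s) /\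
         holomorphic_on Text Omega /\
         (forall z w : C, Omega z \/ nonneg_real z -> Omega w \/ nonneg_real w ->
            Text (Cplus z w) = op_comp (Text z) (Text w))).
Proof.
intros t Ht.
destruct (taylor_family_exists X T t0 Han) as [D HD].
exists (region t0 D); repeat split.
- apply (region_domain T t0 D HD).
- apply (region_domain T t0 D HD).
- intros s Hs; apply (region_real T t0 D HD); lra.
- intros h z; apply region_translate.
- apply (region_add T t0 HT ht0 D HD).
- now apply (region_sector T t0 HT ht0 D HD).
- destruct (extension_exists T t0 HT ht0 D HD) as [Text [HT0 HText]].
  exists Text; split; [intros s _; apply HT0 |]; split.
  + exact (extension_holomorphic T t0 HT ht0 D HD Text HText).
  + intros z w [Hz | [h [Hh ->]]] [Hw | [k [Hk ->]]].
    * now apply (extension_semigroup T t0 HT ht0 D HD Text HText).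
    * rewrite HT0; now apply (extension_translate_r T t0 HT ht0 D HD Text HText).
    * rewrite HT0; now apply (extension_translate_l T t0 HT ht0 D HD Text HText).
    * rewrite <- RtoC_plus, !HT0; now apply HT.
Qed.
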